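(* Let $\mathcal M=(S,S_\Box,S_\bigcirc,\longrightarrow,P)$ be any countable MDP (possibly infinitely branching). Then for every $\varepsilon>0$ there exists a memoryless deterministic (MD) strategy $\sigma$ that is uniformly $\varepsilon$-optimal for $\mathtt{Transience}$, i.e. $\mathcal P_{\mathcal M,s,\sigma}(\mathtt{Transience})\ge \mathtt{val}_{\mathcal M,\mathtt{Transience}}(s)-\varepsilon$ for every $s\in S$. Moreover, there exists a single MD strategy $\sigma^*$ such that for every $s\in S$ for which some (arbitrary) strategy is optimal for $\mathtt{Transience}$ from $s$, the strategy $\sigma^*$ is optimal from $s$, i.e. $\mathcal P_{\mathcal M,s,\sigma^*}(\mathtt{Transience})=\mathtt{val}_{\mathcal M,\mathtt{Transience}}(s)$.
   Context: MDPs: an MDP is a tuple $\mathcal M=(S,S_\Box,S_\bigcirc,\longrightarrow,P)$ where $S$ is a countable set of states partitioned into controlled states $S_\Box$ and random states $S_\bigcirc$, $\longrightarrow\subseteq S\times S$ is a transition relation in which every state has at least one (possibly infinitely many) successor, and $P$ assigns to each random state $s$ a probability distribution $P(s)$ on its successors. A run is an infinite sequence $s_0s_1\cdots$ with $s_i\longrightarrow s_{i+1}$ for all $i$. A strategy is a function $\sigma:S^*S_\Box\to\mathcal D(S)$ (where $\mathcal D(S)$ is the set of probability distributions on $S$) assigning to each finite sequence $\rho s$ ending in a controlled state $s$ a distribution over successors of $s$. A strategy $\sigma$ and initial state $s_0$ induce the usual probability measure $\mathcal P_{\mathcal M,s_0,\sigma}$ on infinite sequences starting in $s_0$ (at random states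 the successor is drawn according to $P$). A strategy is memoryless deterministic (MD) if it is given by a function $\sigma:S_\Box\to S$ choosing a successor of each controlled state. For a measurable objective $\varphi$ (a set of runs), $\mathtt{val}_{\mathcal M,\varphi}(s)=\sup_\sigma \mathcal P_{\mathcal M,s,\sigma}(\varphi)$, the supremum over all strategies. A strategy $\sigma$ is optimal from $s$ if $\mathcal P_{\mathcal M,s,\sigma}(\varphi)=\mathtt{val}_{\mathcal M,\varphi}(s)$. $\mathtt{Transience}$ is the set of runs that visit no state infinitely often. *)

(* Defs.v *)
From HB Require Import structures.
From mathcomp Require Import all_boot all_order all_algebra.
From mathcomp Require Import all_classical all_reals all_analysis.

Set Implicit Arguments.
Unset Strict Implicit.
Unset Printing Implicit Defensive.
Import Order.TTheory GRing.Theory Num.Theory.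
Import numFieldNormedType.Exports.
Local Open Scope classical_set_scope.
Local Open Scope ring_scope.

Record dist (R : realType) (S : countType) := Dist {
  pmf :> S -> R;
  pmf_ge0 : forall t, 0 <= pmf t;
  pmf_sum1 : (\esum_(t in [set: S]) (pmf t)%:E = 1)%E }.

(* [prob s] is only meaningful at random states, i.e. when [~~ ctrl s]; its
   value at controlled states is never used. *)
Record mdp (R : realType) := Mdp {
  state : countType;
  ctrl : pred state;
  edge : rel state;
  edge_total : forall s, exists t, edge s t;
  prob : state -> dist R state;
  prob_edge : forall s t, ~~ ctrl s -> 0 < prob s t -> edge s t }.

(* [decide rho s] is the distribution chosen after the history [rho] followed by
   the current state [s]; it is only used when [ctrl s]. *)
Record strategy (R : realType) (M : mdp R) := Strategy {
  decide :> seq (state M) -> state M -> dist R (state M);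
  decide_edge : forall rho s t,
    ctrl s -> 0 < decide rho s t -> edge s t }.

(* Since [decide_edge] holds, [f s] is automatically a successor of [s]. *)
Definition is_MD (R : realType) (M : mdp R) (sigma : strategy M) :=
  exists f : state M -> state M, forall rho s, ctrl s ->
    forall t, sigma rho s t = (t == f s)%:R.

Definition step (R : realType) (M : mdp R) (sigma : strategy M)
    (rho : seq (state M)) (s : state M) : dist R (state M) :=
  if ctrl s then sigma rho s else prob s.

(* Probability that a process with transition kernel [K], after the history [rho]
   followed by [s], next visits the entries of [w], in that order. *)
Fixpoint path_prob (R : realType) (S : countType) (K : seq S -> S -> dist R S)
    (rho : seq S) (s : S) (w : seq S) : R :=
  if w is t :: w' then K rho s t * path_prob K (rcons rho s) t w' else 1.

Definition cylinder (S : Type) (w : seq S) : set (nat -> S) :=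
  [set x | mkseq x (size w) = w].

Definition cylinders (S : Type) : set (set (nat -> S)) := range (@cylinder S).

(* A measurable type has to be pointed and [S] may be empty, hence the dummy
   index [s0], whose only role is to provide a point. *)
Definition pseqs (S : countType) (s0 : S) := nat -> S.
HB.instance Definition _ (S : countType) (s0 : S) :=
  Choice.copy (pseqs s0) (nat -> S).
HB.instance Definition _ (S : countType) (s0 : S) :=
  isPointed.Build (pseqs s0) (fun=> s0).

Definition seqs (S : countType) (s0 : S) : measurableType _ :=
  @g_sigma_algebraType (pseqs s0) (@cylinders S).

Definition induced (R : realType) (M : mdp R) (sigma : strategy M)
    (s : state M) (mu : probability (seqs s) R) :=
  forall w, mu (cylinder (s :: w)) = (path_prob (step sigma) [::] s w)%:E.

(* By [Pr_induced] and [induced_unique], this is the measure satisfying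
   [induced], determined on all measurable sets. *)
Definition Pr (R : realType) (M : mdp R) (sigma : strategy M) (s : state M)
    : probability (seqs s) R :=
  get [set mu | induced sigma mu].

Definition value (R : realType) (M : mdp R) (phi : set (nat -> state M))
    (s : state M) : \bar R :=
  ereal_sup [set Pr sigma s phi | sigma in [set: strategy M]].

Definition optimal (R : realType) (M : mdp R) (phi : set (nat -> state M))
    (sigma : strategy M) (s : state M) :=
  Pr sigma s phi = value phi s.

Definition is_run (R : realType) (M : mdp R) (x : nat -> state M) :=
  forall i, edge (x i) (x i.+1).

Definition Transience (R : realType) (M : mdp R) : set (nat -> state M) :=
  [set x | is_run x /\ forall s, ~ infinite_set [set n | x n = s]].

(* Existence of the induced measure: each finite path is assigned a subinterval
   of [0, 1[ whose length is its probability, the interval of a path being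
   partitioned by those of its one-step extensions; the measure is the image of
   the Lebesgue measure by the map sending u to the path whose prefixes have u in
   their intervals. *)
Section existence.
Variables (R : realType) (S : countType).

Let c (d : dist R S) (k : nat) : R :=
  if (pickle_inv k : option S) is Some t then d t else 0.

Let F (d : dist R S) (n : nat) : R := \sum_(0 <= k < n) c d k.

Let c_ge0 d k : 0 <= c d k.
Proof. by rewrite /c; case: pickle_inv => // t; exact: pmf_ge0. Qed.

Let c_pickle d t : c d (pickle t) = d t.
Proof. by rewrite /c pickleK_inv. Qed.

Let FS d n : F d n.+1 = F d n + c d n.
Proof. by rewrite /F big_nat_recr. Qed.

Let F0 d : F d 0 = 0. Proof. by rewrite /F big_geq. Qed.

Let F_homo d m n : (m <= n)%N -> F d m <= F d n.
Proof.
move=> /subnK <-; elim: (n - m)%N => [//|k IH].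
by rewrite addSn FS (le_trans IH)// lerDl.
Qed.

Let sum_c d : (\sum_(0 <= k <oo) (c d k)%:E = 1)%E.
Proof.
rewrite nneseries_esumT; last by move=> k; rewrite lee_fin.
rewrite -(pmf_sum1 d).
under [RHS]eq_esum => t _ do rewrite -c_pickle.
have pbij : set_bij [set: S] (range (@pickle S)) (@pickle S).
  split; [by move=> x _; exists x| |by move=> _ [x _ <-]; exists x].
  by move=> x y _ _; apply: (pcan_inj pickleK_inv).
rewrite -(@reindex_esum R _ _ _ _ _ (fun k => (c d k)%:E) pbij).
rewrite [RHS]esum_mkcond; apply: eq_esum => k _.
case: ifPn => // /negP kS; rewrite /c; case E: (pickle_inv k) => [t|//].
exfalso; apply: kS; rewrite inE; exists t => //.
by have := @pickle_invK S k; rewrite E.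
Qed.

Let F_gt d (y : R) : y < 1 -> exists n, y < F d n.
Proof.
move=> y1; apply: contrapT => /forallNP H.
have : (\sum_(0 <= k <oo) (c d k)%:E <= y%:E)%E.
  apply: lime_le.
    by apply: is_cvg_nneseries => k _ _; rewrite lee_fin.
  apply: nearW => n; rewrite sumEFin lee_fin leNgt; apply/negP.
  exact: H.
by rewrite sum_c lee_fin leNgt y1.
Qed.

Let F_le1 d n : F d n <= 1.
Proof.
rewrite -lee_fin -(sum_c d) /F -sumEFin.
by apply: nneseries_lim_ge => k _; rewrite lee_fin.
Qed.

Let F_cover d (y : R) : 0 <= y -> y < 1 ->
  exists t : S, F d (pickle t) <= y < F d (pickle t).+1.
Proof.
move=> y0 y1; have [n nP nmin] := ex_minnP (F_gt d y1).
case: n nP nmin => [|k] nP nmin; first by move: nP; rewrite F0 ltNge y0.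
have Fk : F d k <= y by rewrite leNgt; apply/negP => /nmin; rewrite ltnn.
have := le_lt_trans Fk nP; rewrite FS ltrDl {1}/c.
case E: (pickle_inv k) => [t|]; last by rewrite ltxx.
move=> _; exists t.
by have := @pickle_invK S k; rewrite E /= => ->; rewrite Fk nP.
Qed.

Let F_uniq d (y : R) (t t' : S) :
  F d (pickle t) <= y < F d (pickle t).+1 ->
  F d (pickle t') <= y < F d (pickle t').+1 -> t = t'.
Proof.
move=> /andP[a b] /andP[a' b']; apply: (pcan_inj pickleK_inv).
apply/eqP; rewrite eqn_leq; apply/andP; split; rewrite leqNgt; apply/negP => h.
  by have := lt_le_trans b' (le_trans (F_homo d h) a); rewrite ltxx.
by have := lt_le_trans b (le_trans (F_homo d h) a'); rewrite ltxx.
Qed.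

(* A state (a, l, rho, s) of the interval process: the current interval is
   [a, a + l[, the history is rho and the current state is s. *)
Variable K : seq S -> S -> dist R S.

Let st := (R * R * (seq S * S))%type.

Let sub (z : st) (t : S) : st :=
  let: (a, l, (rho, s)) := z in
  (a + l * F (K rho s) (pickle t), l * K rho s t, (rcons rho s, t)).

Let itv (z : st) : set R := [set u | z.1.1 <= u < z.1.1 + z.1.2].

Let next (u : R) (z : st) : st := sub z (xget z.2.2 [set t | itv (sub z t) u]).

Let walk (z : st) (w : seq S) : st := foldl sub z w.

Let walk_len z w : 0 <= z.1.2 -> 0 <= (walk z w).1.2.
Proof.
elim: w z => [//|t w IH] [[a l] [rho s]] /= l0; apply: IH => /=.
by rewrite mulr_ge0// pmf_ge0.
Qed.

Let itv_sub z t : 0 <= z.1.2 -> itv (sub z t) `<=` itv z.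
Proof.
case: z => [[a l] [rho s]] /= l0 u /=; rewrite /itv/= => /andP[h1 h2].
rewrite (le_trans _ h1) ?lerDl ?mulr_ge0//=; last first.
  by rewrite -(F0 (K rho s)) F_homo.
rewrite (lt_le_trans h2)// -addrA lerD2l -mulrDr -c_pickle -FS.
by rewrite ler_piMr.
Qed.

Let sub_len z t : 0 <= z.1.2 -> 0 <= (sub z t).1.2.
Proof. exact: (@walk_len z [:: t]). Qed.

Let itv_walk z w : 0 <= z.1.2 -> itv (walk z w) `<=` itv z.
Proof.
elim: w z => [|t w IH] z l0 u //= h; apply: (itv_sub l0).
by apply: IH h; exact: sub_len.
Qed.

Let itv_subE a l rho s t u : 0 < l -> itv (sub (a, l, (rho, s)) t) u <->
  F (K rho s) (pickle t) <= (u - a) / l < F (K rho s) (pickle t).+1.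
Proof.
move=> l0; rewrite /itv /= FS c_pickle ler_pdivlMr// ltr_pdivrMr//.
rewrite lerBrDl ltrBlDl mulrDl (mulrC _ l) (mulrC (K rho s t)) addrA.
by [].
Qed.

Let itv_pos z u : itv z u -> 0 < z.1.2.
Proof. by rewrite /itv/= => /andP[h1 /(le_lt_trans h1)]; rewrite ltrDl. Qed.

Let itv_ex z u : itv z u -> exists t, itv (sub z t) u.
Proof.
move=> zu; have l0 := itv_pos zu.
case: z zu l0 => [[a l] [rho s]]; rewrite {1}/itv /= => /andP[h1 h2] l0.
have [||t tP] := @F_cover (K rho s) ((u - a) / l).
- by rewrite divr_ge0 ?subr_ge0// ltW.
- by rewrite ltr_pdivrMr// mul1r ltrBlDl.
by exists t; apply/itv_subE.
Qed.

Let itv_uniq z u t t' : itv z u -> itv (sub z t) u -> itv (sub z t') u -> t = t'.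
Proof.
move=> zu; have l0 := itv_pos zu.
case: z zu l0 => [[a l] [rho s]] _ l0 /itv_subE-/(_ l0) h /itv_subE-/(_ l0).
exact: F_uniq h.
Qed.

Let nextP z u : itv z u -> itv (next u z) u.
Proof. by move=> /itv_ex; exact: xgetPex. Qed.

Let traj (z : st) (u : R) : nat -> S := fun n => (iter n (next u) z).2.2.

Let sub_last z t : (sub z t).2.2 = t.
Proof. by case: z => [[a l] [rho s]]. Qed.

Let traj_itv z u w : 0 <= z.1.2 -> itv z u ->
  (mkseq (traj z u) (size w).+1 = z.2.2 :: w <-> itv (walk z w) u).
Proof.
elim: w z => [|t w IH] z l0 zu; first by [].
have -> : mkseq (traj z u) (size (t :: w)).+1 =
    z.2.2 :: mkseq (traj (next u z) u) (size w).+1.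
  rewrite /mkseq -[iota 0 _]/(0%N :: iota (1 + 0) (size w).+1) iotaDl.
  rewrite map_cons -map_comp; congr (_ :: _).
  by apply: eq_map => i; rewrite /traj -iterSr.
have nu := nextP zu.
have [t' tE] : exists t', next u z = sub z t' by eexists; reflexivity.
rewrite tE /= in nu *.
have := IH (sub z t') (sub_len _ l0) nu; rewrite sub_last => IHt'.
split.
  move=> [] e1 e2; rewrite -e1.
  have -> : traj (sub z t') u 0 = t' by rewrite /traj /= sub_last.
  apply/IHt'; move: e2; rewrite /mkseq /= => ->.
  by rewrite /traj /= sub_last.
move=> h; have tu : itv (sub z t) u by apply: itv_walk h => //; exact: sub_len.
have tt := itv_uniq zu nu tu; subst t'.
by congr (_ :: _); apply/IHt'.
Qed.

Variable s0 : S.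
Let z0 : st := (0, 1, ([::], s0)).
Let U : set R := itv z0.
Let X (u : measurableTypeR R) : seqs s0 := if u \in U then traj z0 u else fun=> s0.

Let mitv z : measurable (itv z : set (measurableTypeR R)).
Proof.
exact: (measurable_itv `[z.1.1, z.1.1 + z.1.2[).
Qed.

Let X_cyl w : U `&` X @^-1` cylinder (s0 :: w) = itv (walk z0 w).
Proof.
apply/seteqP; split => u /=.
  move=> [Uu]; rewrite /X /cylinder /= mem_set// => h.
  by apply/(@traj_itv z0) => //; rewrite /= ler01.
move=> h; have Uu : U u by apply: itv_walk h; rewrite /= ler01.
split=> //; rewrite /X mem_set//.
by apply/(@traj_itv z0 u w) => //=; rewrite ler01.
Qed.

Let X_cyl0 w t : t != s0 -> X @^-1` cylinder (t :: w) = set0.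
Proof.
move=> ts; apply/seteqP; split => u //=; rewrite /cylinder /= => -[e _].
move: ts; rewrite -e /X; case: ifP => _; last by rewrite eqxx.
by rewrite /traj /= eqxx.
Qed.

Let mX : measurable_fun [set: measurableTypeR R] X.
Proof.
apply: (@measurability _ _ (measurableTypeR R) (seqs s0) setT X (@cylinders S)) => // _ [_ [w _ <-] <-].
rewrite setTI; case: w => [|t w].
  rewrite (_ : cylinder [::] = setT) ?preimage_setT//.
  by apply/seteqP; split.
have [->|ts] := eqVneq t s0; last by rewrite X_cyl0.
rewrite -(setIT (X @^-1` _)) -(setUv U) setIUr; apply: measurableU.
  by rewrite setIC X_cyl; exact: mitv.
have [e|e] := pselect (cylinder (s0 :: w) (fun=> s0)).
  rewrite (_ : _ `&` _ = ~` U); first by apply: measurableC; exact: mitv.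
  apply/seteqP; split => u; first by case.
  by move=> nU; split=> //; rewrite /preimage /= /X memNset.
rewrite (_ : _ `&` _ = set0)//; apply/seteqP; split => u //= [].
by move=> h nU; apply: e; move: h; rewrite /X memNset.
Qed.

Let leb01 : {measure set (measurableTypeR R) -> \bar R} :=
  mrestr (@lebesgue_measure R) (mitv z0).

Let leb_itv z : 0 <= z.1.2 ->
  lebesgue_measure (itv z : set (measurableTypeR R)) = z.1.2%:E.
Proof.
move=> l0; have -> : itv z = [set` `[z.1.1, z.1.1 + z.1.2[ ] by [].
rewrite lebesgue_measure_itv /= lte_fin ltrDl.
case: ltP => [_|h]; first by rewrite -EFinD addrAC subrr add0r.
by apply/esym/congr1/eqP; rewrite eq_le h.
Qed.

Let leb01T : leb01 setT = 1%E.
Proof. by rewrite /leb01 /= /mrestr setTI leb_itv //= ler01. Qed.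

Let walk_prob z w : (walk z w).1.2 = z.1.2 * path_prob K z.2.1 z.2.2 w.
Proof.
elim: w z => [|t w IH] [[a l] [rho s]] /=; first by rewrite mulr1.
by rewrite IH /= mulrA.
Qed.

Lemma path_prob_ex : exists mu : probability (seqs s0) R,
  forall w, mu (cylinder (s0 :: w)) = (path_prob K [::] s0 w)%:E.
Proof.
pose Xm := isMeasurableFun.Build _ _ (measurableTypeR R) (seqs s0) X mX.
pose Y : {mfun measurableTypeR R >-> seqs s0} := HB.pack X Xm.
pose P1 := Measure_isProbability.Build _ _ _ leb01 leb01T.
pose P : probability (measurableTypeR R) R :=
  HB.pack (mrestr (@lebesgue_measure R) (mitv z0)) P1.
exists (distribution P Y) => w.
rewrite /distribution /= /pushforward /= /mrestr setIC X_cyl.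
by rewrite leb_itv ?walk_len ?walk_prob ?mul1r//= ler01.
Qed.

End existence.

Lemma measurable_cylinder (S : countType) (s0 : S) (w : seq S) :
  measurable (cylinder w : set (seqs s0)).
Proof. by apply: sub_sigma_algebra; exists w. Qed.

Lemma cylinderI (S : eqType) (v w : seq S) : (size v <= size w)%N ->
  cylinder v `&` cylinder w = if take (size v) w == v then cylinder w else set0.
Proof.
move=> vw; rewrite /cylinder; apply/seteqP; split => x /=.
  move=> [xv xw]; suff -> : take (size v) w == v by [].
  by rewrite -[X in take _ X]xw /mkseq -map_take take_iota (minn_idPl vw) -{2}xv.
case: eqP => // wv /= xw; split => //; rewrite -[RHS]wv -[in RHS]xw /mkseq.
by rewrite -map_take take_iota (minn_idPl vw).
Qed.

Lemma induced_unique (R : realType) (M : mdp R) (sigma : strategy M)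
    (s : state M) (mu nu : probability (seqs s) R) :
  induced sigma mu -> induced sigma nu ->
  forall A : set (seqs s), measurable A -> mu A = nu A.
Proof.
move=> muP nuP; pose G := [set A | A = set0 \/ @cylinders (state M) A].
have cylT : cylinder [::] = [set: seqs s] by apply/seteqP; split.
apply: (@measure_unique _ _ (seqs s) G (fun=> setT)).
- apply/seteqP; split.
    apply: sub_smallest2r; first exact: smallest_sigma_algebra.
    by move=> A; right.
  apply: smallest_sub; first exact: sigma_algebra_measurable.
  move=> _ [->|[w _ <-]]; first exact: measurable0.
  exact: measurable_cylinder.
- have GI v w : (size v <= size w)%N -> G (cylinder v `&` cylinder w).
    by move=> /cylinderI ->; case: ifP => _; [right; exists w|left].
  move=> _ _ [->|[v _ <-]] [->|[w _ <-]]; rewrite ?set0I ?setI0; try by left.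
  by case: (leqP (size v) (size w)) => [/GI//|/ltnW /GI]; rewrite setIC.
- by move=> _; right; exists [::].
- by apply/seteqP; split => // x _; exists 0%N.
- move=> _ [->|[[|t w] _ <-]]; first by rewrite !measure0.
    by rewrite cylT; transitivity (1 : \bar R)%E;
      [exact: (probability_setT mu)|exact/esym/(probability_setT nu)].
  have [->|ts] := eqVneq t s; first by rewrite [LHS]muP [RHS]nuP.
  have z (P : probability (seqs s) R) : induced sigma P ->
      P (cylinder (t :: w)) = 0%E.
    move=> /(_ [::]) /= P1; apply: (@subset_measure0 _ _ _ P _
      (~` cylinder [:: s])).
    + exact: measurable_cylinder.
    + by apply: measurableC; exact: measurable_cylinder.
    + move=> x; rewrite /cylinder /= => -[xt _] [xs].
      by move: ts; rewrite -xt xs eqxx.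
    + transitivity (1 - P (cylinder [:: s]))%E; last by rewrite [P _]P1 subee.
      by apply: (probability_setC P); exact: measurable_cylinder.
  by rewrite [LHS]z ?[RHS]z.
- by move=> _; apply: (@le_lt_trans _ _ 1%E); [exact: probability_le1|rewrite ltry].
Qed.

Lemma Pr_induced (R : realType) (M : mdp R) (sigma : strategy M)
    (s : state M) : induced sigma (Pr sigma s).
Proof.
by have [mu muP] := path_prob_ex (step sigma) s; apply: getPex; exists mu.
Qed.

Lemma measurable_bigcup_ctbl d (T : measurableType d) (I : countType)
    (D : set I) (F : I -> set T) :
  (forall i, D i -> measurable (F i)) -> measurable (\bigcup_(i in D) F i).
Proof.
move=> mF; rewrite bigcup_mkcond; apply: countable_bigcupT_measurable.
  exact: countableP.
by move=> i; case: ifPn => // /set_mem /mF.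
Qed.

Lemma measurable_bigcap_ctbl d (T : measurableType d) (I : countType)
    (F : I -> set T) :
  (forall i, measurable (F i)) -> measurable (\bigcap_i F i).
Proof.
move=> mF; rewrite -[X in measurable X]setCK setC_bigcap.
apply/measurableC/measurable_bigcup_ctbl => i _.
by apply: measurableC; exact: mF.
Qed.

Lemma measurable_coord (S : countType) (s0 : S) (n : nat) (B : set S) :
  measurable ([set x | B (x n)] : set (seqs s0)).
Proof.
have -> : [set x | B (x n)] =
    \bigcup_(w in [set w : seq S | B (nth s0 w n) /\ size w = n.+1])
      cylinder w.
  apply/seteqP; split => x /=.
    move=> Bx; exists (mkseq x n.+1).
      by split; [rewrite nth_mkseq|exact: size_mkseq].
    by congr mkseq; exact: size_mkseq.
  move=> [w [Bw sw]]; rewrite /cylinder /= sw => xw.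
  by rewrite -xw nth_mkseq in Bw.
by apply: measurable_bigcup_ctbl => w _; exact: measurable_cylinder.
Qed.

Lemma measurable_Transience (R : realType) (M : mdp R) (s0 : state M) :
  measurable (@Transience R M : set (seqs s0)).
Proof.
have -> : @Transience R M =
  (\bigcap_i \bigcup_(t in [set: state M])
      ([set x | x i = t] `&` [set x | edge t (x i.+1)]))
  `&` \bigcap_s \bigcup_N \bigcap_n [set x | (N <= n)%N -> x n <> s].
  apply/seteqP; split => x [xr xt]; split.
  - by move=> i _; exists (x i) => //; split => //=; exact: xr.
  - move=> s _; have /finite_seqP[A AE] := contrapT (xt s).
    exists (\max_(i <- A) i).+1 => // n _ /= An xns.
    have nA : [set` A] n by rewrite -AE.
    by move: An; rewrite ltnNge (@leq_bigmax_seq _ A xpredT id n).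
  - by move=> i; have [t _ /= [<-]] := xr i Logic.I.
  - move=> s; apply; have [N _ Nx] := xt s Logic.I.
    apply: (@sub_finite_set _ _ `I_N) (finite_II N) => n /= xn.
    by rewrite ltnNge; apply/negP => /(Nx n Logic.I).
apply: measurableI.
  apply: measurable_bigcap_ctbl => i; apply: measurable_bigcup_ctbl => t _.
  apply: measurableI.
    exact: (measurable_coord i [set u | u = t]).
  exact: (measurable_coord i.+1 [set u | edge t u]).
apply: measurable_bigcap_ctbl => s; apply: measurable_bigcup_ctbl => N _.
apply: measurable_bigcap_ctbl => n.
exact: (measurable_coord n [set u | (N <= n)%N -> u <> s]).
Qed.

(* Main.v *)
Require Import Defs.
From HB Require Import structures.
From mathcomp Require Import all_boot all_order all_algebra.
From mathcomp Require Import all_classical all_reals all_analysis.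
From mathcomp Require Import measurable_realfun lra.
Set Implicit Arguments.
Unset Strict Implicit.
Unset Printing Implicit Defensive.
Import Order.TTheory GRing.Theory Num.Theory.
Import numFieldNormedType.Exports.
Local Open Scope classical_set_scope.
Local Open Scope ring_scope.

(** Kill the process at each visit to a state [t] with a small probability
    [c t > 0], and let [V] be the largest subsolution of the Bellman equation for
    surviving and escaping to infinity.

    Under a memoryless strategy a path that visits a state infinitely often is
    killed almost surely, so following almost optimal successors for [V] gives an
    MD strategy with escape probability at least [V - eps]; the choice costs only
    [eps] in total because an error [c t * eps] at [t] is paid for by the killing
    rate.  It remains to choose [c] so small that [V] is close to the value for
    every state at once, although the paths are infinite.  For the i-th state fix
    one almost optimal strategy and make [c] small along almost all of its escaping
    paths, that is, as a function of the time after which a state is unlikely to be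
    visited again.  This uses only the rates of the states from the i-th on; the
    states before it are dealt with by induction on i.

    For the optimality of a single strategy the same argument is applied to
    optimal strategies only, with errors proportional to the value [v], which is
    harmonic under them.  With [eps = 1/4] it gives an MD strategy whose surviving
    value never falls below [v / 2], and a bound [v - g <= th * v] on the defect of
    its escape probability [g] then improves to [v - g <= (th / 2) * v]. *)

(** * Expectation of bounded nonnegative functions under a discrete distribution *)

Definition bounded_nonneg (R : realType) (T : Type) (u : T -> R) :=
  exists C, forall t, 0 <= u t <= C.

Section bounded_nonneg.
Variables (R : realType) (T : Type).
Implicit Types u w : T -> R.

Lemma bounded_nonneg_ge0 u t : bounded_nonneg u -> 0 <= u t.
Proof. by case=> C /(_ t)/andP[]. Qed.

Lemma bounded_nonneg01 u : (forall t, 0 <= u t <= 1) -> bounded_nonneg u.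
Proof. by move=> u01; exists 1. Qed.

Lemma bounded_nonneg_cst (a : R) : 0 <= a -> bounded_nonneg (fun _ : T => a).
Proof. by move=> a0; exists a => t; rewrite a0 lexx. Qed.

Lemma bounded_nonnegD u w : bounded_nonneg u -> bounded_nonneg w ->
  bounded_nonneg (fun t => u t + w t).
Proof.
move=> [C uC] [D wD]; exists (C + D) => t.
by have /andP[? ?] := uC t; have /andP[? ?] := wD t; rewrite addr_ge0// lerD.
Qed.

Lemma bounded_nonnegM u w : bounded_nonneg u -> bounded_nonneg w ->
  bounded_nonneg (fun t => u t * w t).
Proof.
move=> [C uC] [D wD]; exists (C * D) => t.
by have /andP[? ?] := uC t; have /andP[? ?] := wD t; rewrite mulr_ge0// ler_pM.
Qed.

Lemma bounded_nonnegZ (a : R) u : 0 <= a -> bounded_nonneg u ->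
  bounded_nonneg (fun t => a * u t).
Proof. by move=> a0; apply: bounded_nonnegM; exact: bounded_nonneg_cst. Qed.

End bounded_nonneg.
#[local] Hint Resolve bounded_nonneg_cst bounded_nonnegD bounded_nonnegZ : core.

(** Makes series lemmas and countable sums of measures applicable to sums over a countable type;
    indices that code no state contribute 0. *)
Lemma esum_pickle_inv (R : realType) (S : countType) (a : S -> \bar R) :
  (forall t, 0 <= a t)%E ->
  (\esum_(t in [set: S]) a t =
   \sum_(0 <= k <oo) (if (pickle_inv k : option S) is Some t then a t else 0))%E.
Proof.
move=> a0; rewrite nneseries_esumT; last by move=> k; case: pickle_inv.
have pbij : set_bij [set: S] (range (@pickle S)) (@pickle S).
  split; [by move=> x _; exists x| |by move=> _ [x _ <-]; exists x].
  by move=> x y _ _; apply: (pcan_inj pickleK_inv).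
transitivity (\esum_(t in [set: S])
   (fun k => if (pickle_inv k : option S) is Some t then a t else 0)%E (pickle t)).
  by apply: eq_esum => t _; rewrite pickleK_inv.
rewrite -(@reindex_esum R _ _ _ _ _
  (fun k => if (pickle_inv k : option S) is Some t then a t else 0)%E pbij).
rewrite esum_mkcond; apply: eq_esum => k _.
case: ifPn => // /negP kS; case E: (pickle_inv k) => [t|//].
exfalso; apply: kS; rewrite inE; exists t => //.
by have := @pickle_invK S k; rewrite E.
Qed.

Section expectation.
Variables (R : realType) (S : countType).
Implicit Types (d : dist R S) (u w : S -> R).

(** Taking [fine] is faithful for bounded nonnegative [u], whose sum is finite ([ExE]). *)
Definition Ex d u : R := fine (\esum_(t in [set: S]) (d t * u t)%:E)%E.

Let term_ge0 d u t : bounded_nonneg u -> (0 <= (d t * u t)%:E)%E.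
Proof.
by move=> bu; rewrite lee_fin mulr_ge0 ?Defs.pmf_ge0 ?bounded_nonneg_ge0.
Qed.

Let esumZ d a u : 0 <= a -> bounded_nonneg u ->
  (\esum_(t in [set: S]) (d t * (a * u t))%:E =
   a%:E * \esum_(t in [set: S]) (d t * u t)%:E)%E.
Proof.
move=> a0 bu; rewrite !esum_pickle_inv; first last.
- by move=> t; exact: (@term_ge0 d (fun t => a * u t) t (bounded_nonnegZ a0 bu)).
- by move=> t; exact: (@term_ge0 d u t bu).
rewrite -nneseriesZl; last by move=> k _; case: pickle_inv => // t; exact: term_ge0.
apply: eq_eseriesr => k _; case: pickle_inv => [t|]; last by rewrite mule0.
by rewrite -EFinM mulrCA.
Qed.

Let esum_fin d u : bounded_nonneg u ->
  (\esum_(t in [set: S]) (d t * u t)%:E \is a fin_num)%E.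
Proof.
move=> bu; have [C uC] := bu; rewrite ge0_fin_numE; last first.
  by apply: esum_ge0 => t _; exact: term_ge0.
have [S0|] := pselect (exists t : S, True); last first.
  move=> nS; rewrite esum1 ?ltry// => t; exfalso; apply: nS; by exists t.
have C0 : 0 <= C by case: S0 => t _; case/andP: (uC t) => /le_trans; apply.
apply: (@le_lt_trans _ _ C%:E); last by rewrite ltry.
rewrite -[C%:E]mule1 -(Defs.pmf_sum1 d).
under [X in (_ * X)%E]eq_esum => t _ do rewrite -[d t]mulr1.
rewrite -esumZ//; last exact: bounded_nonneg_cst.
apply: le_esum => t _; rewrite lee_fin mulr1 ler_wpM2l ?Defs.pmf_ge0//.
by case/andP: (uC t).
Qed.

Lemma ExE d u : bounded_nonneg u ->
  (\esum_(t in [set: S]) (d t * u t)%:E = (Ex d u)%:E)%E.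
Proof. by move=> bu; rewrite /Ex fineK// esum_fin. Qed.

Lemma Ex_ge0 d u : bounded_nonneg u -> 0 <= Ex d u.
Proof.
move=> bu; rewrite -lee_fin -ExE//.
by apply: esum_ge0 => t _; exact: term_ge0.
Qed.

Lemma Ex_cst d a : 0 <= a -> Ex d (fun=> a) = a.
Proof.
move=> a0; apply: EFin_inj; rewrite -ExE; last exact: bounded_nonneg_cst.
rewrite -[RHS]mule1 -(Defs.pmf_sum1 d).
under [X in (_ * X)%E]eq_esum => t _ do rewrite -[d t]mulr1.
rewrite -esumZ//; last exact: bounded_nonneg_cst.
by apply: eq_esum => t _; rewrite mulr1.
Qed.

Lemma ExD d u w : bounded_nonneg u -> bounded_nonneg w ->
  Ex d (fun t => u t + w t) = Ex d u + Ex d w.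
Proof.
move=> bu bw; apply: EFin_inj; rewrite EFinD -!ExE//; last exact: bounded_nonnegD.
rewrite -esumD; first last.
- by move=> t _; exact: term_ge0.
- by move=> t _; exact: term_ge0.
by apply: eq_esum => t _; rewrite mulrDr.
Qed.

Lemma ExZ d a u : 0 <= a -> bounded_nonneg u ->
  Ex d (fun t => a * u t) = a * Ex d u.
Proof.
move=> a0 bu; apply: EFin_inj; rewrite EFinM -!ExE//; last exact: bounded_nonnegZ.
exact: esumZ.
Qed.

Lemma le_Ex d u w : bounded_nonneg u -> bounded_nonneg w ->
  (forall t, 0 < d t -> u t <= w t) -> Ex d u <= Ex d w.
Proof.
move=> bu bw uw; rewrite -lee_fin -!ExE//.
apply: le_esum => t _; rewrite lee_fin.
have := Defs.pmf_ge0 d t; rewrite le_eqVlt => /predU1P[<-|dt].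
  by rewrite !mul0r.
by rewrite ler_pM2l// uw.
Qed.

Lemma eq_Ex d u w : bounded_nonneg u -> bounded_nonneg w ->
  (forall t, 0 < d t -> u t = w t) -> Ex d u = Ex d w.
Proof.
by move=> bu bw uw; apply/le_anti; rewrite !le_Ex// => t /uw ->.
Qed.

(** A strict gap at one point of positive mass would already separate the two expectations. *)
Lemma Ex_squeeze d u w : bounded_nonneg u -> bounded_nonneg w ->
  (forall t, 0 < d t -> u t <= w t) -> Ex d w <= Ex d u ->
  forall t, 0 < d t -> u t = w t.
Proof.
move=> bu bw uw wu t dt; apply/le_anti; rewrite uw//=.
(* The gap concentrated at [t]: [u + e] still lies below [w] on the support of [d]. *)
pose e s := if s == t then w t - u t else 0.
have be : bounded_nonneg e.
  exists (w t - u t) => s; have := uw t dt; rewrite -subr_ge0 => h.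
  by rewrite /e; case: ifP => _; rewrite ?h ?lexx.
have : Ex d (fun s => u s + e s) <= Ex d w.
  apply: le_Ex => //; first exact: bounded_nonnegD.
  by move=> s ds; rewrite /e; case: eqP => [->|_]; rewrite ?subrKC ?addr0 ?uw.
rewrite ExD// => h.
have : d t * e t <= Ex d e.
  rewrite -lee_fin -ExE// -(@esum_set1 _ _ t (fun s => (d s * e s)%:E)); last first.
    exact: term_ge0.
  by rewrite [leLHS]esum_mkcond; apply: le_esum => s _; case: ifP => // _; exact: term_ge0.
rewrite /e eqxx => h2.
have : d t * (w t - u t) <= 0 by lra.
by rewrite pmulr_rle0// subr_le0.
Qed.

(** Otherwise [u] is strictly below its mean on the support, and [Ex_squeeze] against the constant
    mean leaves [d] without mass. *)
Lemma Ex_mean d u : bounded_nonneg u -> exists2 t, 0 < d t & Ex d u <= u t.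
Proof.
move=> bu; apply: contrapT => H.
have lt t : 0 < d t -> u t < Ex d u.
  by move=> dt; rewrite ltNge; apply/negP => h; apply: H; exists t.
have bE := @bounded_nonneg_cst R S _ (Ex_ge0 d bu).
have eq := @Ex_squeeze d u _ bu bE (fun t dt => ltW (lt t dt)).
have {}eq : forall t, 0 < d t -> u t = Ex d u.
  by apply: eq; rewrite Ex_cst ?Ex_ge0.
have d0 t : d t = 0.
  apply/le_anti; rewrite Defs.pmf_ge0 andbT leNgt; apply/negP => dt.
  by have := lt t dt; rewrite eq ?ltxx.
have := Defs.pmf_sum1 d; rewrite esum1; last by move=> t _; rewrite d0.
by move=> /eqP; rewrite eqe eq_sym oner_eq0.
Qed.

Lemma Ex_dirac d t u : bounded_nonneg u -> (forall s, d s = (s == t)%:R) ->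
  Ex d u = u t.
Proof.
move=> bu dE; rewrite -[RHS](Ex_cst d) ?bounded_nonneg_ge0//.
apply: eq_Ex => //; first by apply: bounded_nonneg_cst; exact: bounded_nonneg_ge0.
by move=> s; rewrite dE; case: eqP => [->//|_]; rewrite ltxx.
Qed.

End expectation.

(** * Conditioning on the first step of a run *)

Section residual.
Variables (R : realType) (M : mdp R).
Notation S := (state M).
Implicit Types (sig : strategy M) (s t : S) (x y : nat -> S).

(** What remains of [sig] once the run has left [s]; the state [s] stays at the head of every
    history. *)
Definition residual sig s : strategy M :=
  Strategy (fun rho t u => @decide_edge R M sig (s :: rho) t u).

Lemma path_prob_residual sig s rho t w :
  path_prob (step (residual sig s)) rho t w = path_prob (step sig) (s :: rho) t w.
Proof. by elim: w rho t => [//|u w IH] rho t /=; rewrite IH. Qed.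

Definition scons s y : nat -> S := fun n => if n is m.+1 then y m else s.

Lemma scons_cylinder s w :
  scons s @^-1` cylinder (s :: w) = cylinder w.
Proof.
have E y : mkseq (scons s y) (size w).+1 = s :: mkseq y (size w).
  rewrite /mkseq -[iota 0 _]/(0%N :: iota (1 + 0) (size w)) iotaDl map_cons.
  by rewrite -map_comp.
apply/seteqP; split => y; rewrite /cylinder /preimage /=.
  by rewrite -/(mkseq (scons s y) (size w).+1) E => -[].
by move=> h; rewrite -/(mkseq (scons s y) (size w).+1) E h.
Qed.

Lemma scons_cylinder_neq s t w : t != s ->
  scons s @^-1` cylinder (t :: w) = set0.
Proof.
move=> ts; apply/seteqP; split => y //; rewrite /cylinder /preimage /= => -[e _].
by move: ts; rewrite e eqxx.
Qed.

Lemma measurable_scons s t :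
  measurable_fun [set: seqs t] (scons s : seqs t -> seqs s).
Proof.
apply: (@measurability _ _ (seqs t) (seqs s) setT _ (@cylinders S)) => //.
move=> _ [_ [w _ <-] <-]; rewrite setTI; case: w => [|u w].
  rewrite (_ : cylinder [::] = setT) ?preimage_setT//.
  by apply/seteqP; split.
have [->|us] := eqVneq u s; last by rewrite scons_cylinder_neq.
by rewrite scons_cylinder; exact: measurable_cylinder.
Qed.

Let sconsM s t : {mfun seqs t >-> seqs s} :=
  HB.pack (scons s : seqs t -> seqs s)
    (isMeasurableFun.Build _ _ (seqs t) (seqs s) (scons s) (@measurable_scons s t)).

Lemma Pr_cylinder_neq sig s t w : t != s ->
  Pr sig s (cylinder (t :: w)) = 0%E.
Proof.
move=> ts; have := Pr_induced sig s [::] => /= P1.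
apply: (@subset_measure0 _ _ _ (Pr sig s) _ (~` cylinder [:: s])).
- exact: measurable_cylinder.
- by apply: measurableC; exact: measurable_cylinder.
- move=> x; rewrite /cylinder /= => -[xt _] [xs].
  by move: ts; rewrite -xt xs eqxx.
- transitivity (1 - Pr sig s (cylinder [:: s]))%E; last by rewrite [Pr _ _ _]P1 subee.
  by apply: (probability_setC (Pr sig s)); exact: measurable_cylinder.
Qed.

(** Contribution of the runs whose second state has code [k]. The sum [nu] over [k] is a probability
    satisfying [induced], so uniqueness identifies it with [Pr sig s]. *)
Let branch sig s (k : nat) : {measure set (seqs s) -> \bar R} :=
  if (pickle_inv k : option S) is Some t then
    mscale (NngNum (Defs.pmf_ge0 (step sig [::] s) t))
      (distribution (Pr (residual sig s) t) (sconsM s t))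
  else mzero.

Let nu sig s := mseries (branch sig s) 0.
Arguments nu : clear implicits.

Let nuE sig s A : nu sig s A = (\esum_(t in [set: S])
  ((step sig [::] s t)%:E * Pr (residual sig s) t (scons s @^-1` A)))%E.
Proof.
rewrite esum_pickle_inv; last by move=> t; rewrite mule_ge0// lee_fin Defs.pmf_ge0.
rewrite /nu /mseries; apply: eq_eseriesr => k _.
by rewrite /branch; case: pickle_inv.
Qed.

Let nuT sig s : nu sig s setT = 1%E.
Proof.
rewrite nuE -(Defs.pmf_sum1 (step sig [::] s)); apply: eq_esum => t _.
by rewrite preimage_setT probability_setT mule1.
Qed.

HB.instance Definition _ sig s := Measure.on (nu sig s).
HB.instance Definition _ sig s :=
  Measure_isProbability.Build _ _ _ (nu sig s) (nuT sig s).

Let nu_induced sig s : Defs.induced sig (nu sig s : probability (seqs s) R).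
Proof.
move=> w; apply: (eq_trans (@nuE sig s (cylinder (s :: w)))).
rewrite scons_cylinder; case: w => [|t w] /=.
  rewrite -(Defs.pmf_sum1 (step sig [::] s)); apply: eq_esum => t _.
  rewrite (_ : cylinder [::] = setT) ?probability_setT ?mule1//.
  by apply/seteqP; split.
rewrite (_ : (fun t0 => _) = fun t0 => (if t0 \in [set t] then (step sig [::] s t *
   path_prob (step sig) [:: s] t w)%:E else 0)%E).
  rewrite -[LHS]esum_mkcond esum_set1// lee_fin.
  rewrite -path_prob_residual mulr_ge0 ?Defs.pmf_ge0//.
  by rewrite -lee_fin -(Pr_induced (residual sig s) t w).
apply/funext => u; case: ifPn => [/set_mem ->|].
  by rewrite [Pr _ _ _](Pr_induced (residual sig s) t w) path_prob_residual.
move=> /negP ut; rewrite Pr_cylinder_neq ?mule0//.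
by apply/eqP => tu; apply: ut; rewrite inE.
Qed.

Lemma Pr_residual sig s (A : set (nat -> S)) : measurable (A : set (seqs s)) ->
  (Pr sig s A = \esum_(t in [set: S])
    ((step sig [::] s t)%:E * Pr (residual sig s) t (scons s @^-1` A)))%E.
Proof.
move=> mA.
rewrite (induced_unique (Pr_induced sig s) (@nu_induced sig s) mA).
exact: nuE.
Qed.

(** Measurability is asked for every [s] because the measurable type [seqs s] depends on the start
    state. *)
Definition path_fun (F : (nat -> S) -> R) := bounded_nonneg F /\
  forall s, measurable_fun [set: seqs s] (F : seqs s -> R).

Definition Erun sig s (F : (nat -> S) -> R) : R :=
  fine (\int[Pr sig s]_x (F x)%:E)%E.

Lemma path_fun_ge0 F x : path_fun F -> 0 <= F x.
Proof. by move=> [bF _]; exact: bounded_nonneg_ge0. Qed.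

Lemma measurable_path_fun F s : path_fun F ->
  measurable_fun [set: seqs s] ((fun x => (F x)%:E) : seqs s -> \bar R).
Proof. by case=> _ /(_ s) mF; exact/measurable_EFinP. Qed.

Lemma path_funD F G : path_fun F -> path_fun G -> path_fun (fun x => F x + G x).
Proof.
move=> [bF mF] [bG mG]; split=> [|s]; first exact: bounded_nonnegD.
exact: measurable_funD.
Qed.

Lemma path_funM F G : path_fun F -> path_fun G -> path_fun (fun x => F x * G x).
Proof.
move=> [bF mF] [bG mG]; split=> [|s]; first exact: bounded_nonnegM.
exact: measurable_funM.
Qed.

Lemma path_fun_cst a : 0 <= a -> path_fun (fun=> a).
Proof.
by move=> a0; split=> [|s]; [exact: bounded_nonneg_cst|exact: measurable_cst].
Qed.

Lemma path_fun_scons F s : path_fun F -> path_fun (fun y => F (scons s y)).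
Proof.
move=> [[C FC] mF]; split; first by exists C.
by move=> t; apply: (measurableT_comp (mF s)); exact: measurable_scons.
Qed.

Let int_le sig s F C : path_fun F -> (forall x, F x <= C) ->
  (\int[Pr sig s]_x (F x)%:E <= C%:E)%E.
Proof.
move=> pF FC; have C0 : 0 <= C by exact: le_trans (path_fun_ge0 (fun=> s) pF) (FC _).
apply: (@le_trans _ _ (\int[Pr sig s]_x C%:E)%E).
  apply: ge0_le_integral => //.
  - by move=> x _; rewrite lee_fin path_fun_ge0.
  - exact: measurable_path_fun.
  - by move=> x _; rewrite lee_fin.
rewrite integral_cst//.
rewrite [X in (_ * X)%E](_ : _ = 1%E) ?mule1//; exact: probability_setT.
Qed.

Lemma ErunE sig s F : path_fun F -> (\int[Pr sig s]_x (F x)%:E = (Erun sig s F)%:E)%E.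
Proof.
move=> pF; rewrite /Erun fineK// ge0_fin_numE; last first.
  by apply: integral_ge0 => x _; rewrite lee_fin path_fun_ge0.
have [[C FC] _] := pF; apply: (@le_lt_trans _ _ C%:E); last by rewrite ltry.
by apply: int_le => // x; case/andP: (FC x).
Qed.

Lemma Erun_ge0 sig s F : path_fun F -> 0 <= Erun sig s F.
Proof.
move=> pF; rewrite -lee_fin -ErunE//.
by apply: integral_ge0 => x _; rewrite lee_fin path_fun_ge0.
Qed.

Lemma Erun_le sig s F C : path_fun F -> (forall x, F x <= C) -> Erun sig s F <= C.
Proof. by move=> pF FC; rewrite -lee_fin -ErunE//; exact: int_le. Qed.

Lemma le_Erun sig s F G : path_fun F -> path_fun G -> (forall x, F x <= G x) ->
  Erun sig s F <= Erun sig s G.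
Proof.
move=> pF pG FG; rewrite -lee_fin -!ErunE//; apply: ge0_le_integral => //.
- by move=> x _; rewrite lee_fin path_fun_ge0.
- exact: measurable_path_fun.
- by exact: measurable_path_fun.
- by move=> x _; rewrite lee_fin.
Qed.

Lemma ErunD sig s F G : path_fun F -> path_fun G ->
  Erun sig s (fun x => F x + G x) = Erun sig s F + Erun sig s G.
Proof.
move=> pF pG; apply: EFin_inj; rewrite EFinD -!ErunE//; last exact: path_funD.
rewrite -ge0_integralD//.
- by move=> x _; rewrite lee_fin path_fun_ge0.
- exact: measurable_path_fun.
- by move=> x _; rewrite lee_fin path_fun_ge0.
- exact: measurable_path_fun.
Qed.

Lemma ErunZ sig s a F : 0 <= a -> path_fun F ->
  Erun sig s (fun x => a * F x) = a * Erun sig s F.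
Proof.
move=> a0 pF; apply: EFin_inj; rewrite EFinM -!ErunE//; last first.
  by apply: path_funM => //; exact: path_fun_cst.
rewrite -ge0_integralZl//.
- exact: measurable_path_fun.
- by move=> x _; rewrite lee_fin path_fun_ge0.
Qed.

Lemma bounded_nonneg_Erun (sig : S -> strategy M) (F : S -> (nat -> S) -> R) C :
  (forall t, path_fun (F t)) -> (forall t x, F t x <= C) ->
  bounded_nonneg (fun t => Erun (sig t) t (F t)).
Proof. by move=> pF FC; exists C => t; rewrite Erun_ge0//= Erun_le. Qed.

(** Integrating against [nu] splits the integral over the second state, each term being an integral
    against a scaled image measure under [scons s]. *)
Lemma Erun_residual sig s F : path_fun F ->
  Erun sig s F = Ex (step sig [::] s)
    (fun t => Erun (residual sig s) t (fun y => F (scons s y))).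
Proof.
move=> pF; have pFs := path_fun_scons s pF; have [[C FC] _] := pF.
apply: EFin_inj; rewrite -ErunE// -ExE; last first.
  apply: (@bounded_nonneg_Erun (fun=> residual sig s) (fun _ y => F (scons s y)) C) => //.
  by move=> t x; case/andP: (FC (scons s x)).
have mF := @measurable_path_fun F s pF.
have F0 x : (0 <= (F x)%:E)%E by rewrite lee_fin path_fun_ge0.
transitivity (\int[nu sig s]_x (F x)%:E)%E.
  apply: eq_measure_integral => A mA _.
  exact: (induced_unique (Pr_induced sig s) (@nu_induced sig s) mA).
rewrite ge0_integral_measure_series// esum_pickle_inv; last first.
  by move=> t; rewrite lee_fin mulr_ge0 ?Defs.pmf_ge0 ?Erun_ge0.
apply: eq_eseriesr => k _; rewrite /branch; case: pickle_inv => [t|].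
  rewrite ge0_integral_mscale// EFinM; congr (_ * _)%E.
  by rewrite ge0_integral_distribution// -ErunE.
by rewrite integral_measure_zero.
Qed.

End residual.

(** * The escape event, and its agreement with [Transience] up to a null set *)

Definition escape {S : Type} : set (nat -> S) :=
  [set x | forall s, exists N, forall n, (N <= n)%N -> x n <> s].

Section escape.
Variables (R : realType) (M : mdp R).
Notation S := (state M).
Implicit Types (sig : strategy M) (s t : S) (x y : nat -> S).

Lemma escapeP x : escape x <-> forall s, ~ infinite_set [set n | x n = s].
Proof.
split=> xt s.
  apply; have [N Nx] := xt s.
  apply: (@sub_finite_set _ _ `I_N) (finite_II N) => n /= xn.
  by rewrite ltnNge; apply/negP => /Nx.
have /finite_seqP[A AE] := contrapT (xt s).
exists (\max_(i <- A) i).+1 => n An xns.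
have nA : [set` A] n by rewrite -AE.
by move: An; rewrite ltnNge (@leq_bigmax_seq _ A xpredT id n).
Qed.

Lemma escape_scons s y : escape (scons s y) <-> escape y.
Proof.
split=> yt u; have [N Nx] := yt u.
  by exists N => n Nn; have := Nx n.+1 (leqW Nn).
by exists N.+1 => -[//|n] Nn; exact: Nx.
Qed.

Lemma measurable_escape s : measurable (escape : set (seqs s)).
Proof.
have -> : escape =
    \bigcap_(t in [set: S]) \bigcup_N \bigcap_n [set x | (N <= n)%N -> x n <> t].
  apply/seteqP; split => x xt t.
    by move=> _; have [N Nx] := xt t; exists N => // n _; exact: Nx.
  by have [N _ Nx] := xt t Logic.I; exists N => n Nn; exact: (Nx n Logic.I Nn).
apply: measurable_bigcap_ctbl => t; apply: measurable_bigcup_ctbl => N _.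
apply: measurable_bigcap_ctbl => n.
exact: (measurable_coord n [set u | (N <= n)%N -> u <> t]).
Qed.

Lemma Pr_start sig s (B : set S) : ~ B s ->
  Pr sig s ([set x | B (x 0%N)] : set (seqs s)) = 0%E.
Proof.
move=> Bs; have := Pr_induced sig s [::] => /= P1.
apply: (@subset_measure0 _ _ _ (Pr sig s) _ (~` cylinder [:: s])).
- exact: measurable_coord.
- by apply: measurableC; exact: measurable_cylinder.
- by move=> x /= Bx [xs]; apply: Bs; rewrite -xs.
- transitivity (1 - Pr sig s (cylinder [:: s]))%E; last by rewrite [Pr _ _ _]P1 subee.
  by apply: (probability_setC (Pr sig s)); exact: measurable_cylinder.
Qed.

Lemma step_edge sig rho s t : 0 < step sig rho s t -> edge s t.
Proof.
rewrite /step; case: ifPn => [cs|ncs]; first exact: decide_edge.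
exact: prob_edge.
Qed.

Lemma measurable_coord2 (A : S -> S -> Prop) n m s0 :
  measurable ([set x | A (x n) (x m)] : set (seqs s0)).
Proof.
have -> : [set x | A (x n) (x m)] =
    \bigcup_(t in [set: S]) ([set x | x n = t] `&` [set x | A t (x m)]).
  by apply/seteqP; split => x /=; [move=> h; exists (x n)|move=> [t _ [<-]]].
apply: measurable_bigcup_ctbl => t _; apply: measurableI.
  exact: (measurable_coord n [set u | u = t]).
exact: (measurable_coord m [set u | A t u]).
Qed.

(** Removing the first state turns index [n.+1] into [n] for the residual strategy; at index 0 the
    second state is drawn from [step], which charges successors only. *)
Lemma Pr_nonedge sig s n :
  Pr sig s ([set x | ~~ edge (x n) (x n.+1)] : set (seqs s)) = 0%E.
Proof.
elim: n sig s => [|n IH] sig s.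
  rewrite Pr_residual; last exact: (@measurable_coord2 (fun t u => ~~ edge t u)).
  apply: esum1 => t _.
  have [dt|/negP dt] := pselect (0 < step sig [::] s t).
    rewrite [X in (_ * X)%E](_ : _ = 0%E) ?mule0//.
    apply: (@Pr_start _ t [set u | ~~ edge s u]) => /=.
    by rewrite (step_edge dt).
  have -> : step sig [::] s t = 0.
    by apply/le_anti; rewrite Defs.pmf_ge0 andbT leNgt.
  by rewrite mul0e.
rewrite Pr_residual; last exact: (@measurable_coord2 (fun t u => ~~ edge t u)).
by apply: esum1 => t _; rewrite [X in (_ * X)%E](IH (residual sig s) t) mule0.
Qed.

Lemma path_fun_indic (A : set (nat -> S)) :
  (forall s, measurable (A : set (seqs s))) -> path_fun (\1_A : (nat -> S) -> R).
Proof.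
move=> mA; split; last by move=> s; exact: (@measurable_indic _ (seqs s)).
by apply: bounded_nonneg01 => x; rewrite indicE; case: (_ \in _); rewrite ?lexx ?ler01.
Qed.

Lemma Erun_indic sig s (A : set (nat -> S)) : (forall s, measurable (A : set (seqs s))) ->
  (Erun sig s \1_A)%:E = Pr sig s A.
Proof.
move=> mA; rewrite -ErunE; last exact: path_fun_indic.
by rewrite integral_indic// setIT.
Qed.

Definition Pescape sig s : R := Erun sig s \1_escape.

Lemma path_fun_escape : path_fun (\1_escape : (nat -> S) -> R).
Proof. by apply: path_fun_indic; exact: measurable_escape. Qed.

(** An escaping path outside [Transience] leaves the edge relation at some time, which is a
    countable union of null events. *)
Lemma Pr_Transience sig s : Pr sig s (@Transience R M) = (Pescape sig s)%:E.
Proof.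
rewrite /Pescape Erun_indic; last exact: measurable_escape.
pose NR : set (seqs s) := \bigcup_n [set x | ~~ edge (x n) (x n.+1)].
have mNE n : measurable ([set x | ~~ edge (x n) (x n.+1)] : set (seqs s)).
  exact: (@measurable_coord2 (fun t u => ~~ edge t u)).
have mNR : measurable NR by exact: bigcupT_measurable.
have NR0 : Pr sig s NR = 0%E.
  apply/eqP; rewrite -measure_le0.
  apply: (le_trans (measure_sigma_subadditive (Pr sig s) mNE mNR _)) => //.
  by rewrite eseries0// => n _ _; exact: Pr_nonedge.
have mT := @measurable_Transience R M s; have mE := @measurable_escape s.
have sub : @Transience R M `<=` escape by move=> x [_ /escapeP].
apply/le_anti/andP; split.
  by apply: le_measure => //; rewrite inE.
apply: (@le_trans _ _ (Pr sig s ((@Transience R M : set (seqs s)) `|` NR))).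
  apply: le_measure; rewrite ?inE//; first exact: measurableU.
  move=> x xe; have [xr|/forallNP xr] := pselect (exists n, ~~ edge (x n) (x n.+1)).
    by right; have [n xn] := xr; exists n.
  left; split; last by move/escapeP: xe.
  by move=> i; apply/negPn/negP; exact: xr.
apply: (le_trans (measureU2 (Pr sig s) mT mNR)) => //.
by rewrite [X in (_ + X)%E]NR0 adde0.
Qed.

Lemma Pescape_ge0 sig s : 0 <= Pescape sig s.
Proof. exact: Erun_ge0 path_fun_escape. Qed.

Lemma Pescape_le1 sig s : Pescape sig s <= 1.
Proof.
by apply: Erun_le path_fun_escape _ => x; rewrite indicE; case: (_ \in _); rewrite ?lexx ?ler01.
Qed.

Lemma bounded_nonneg_Pescape (tau : S -> strategy M) :
  bounded_nonneg (fun t => Pescape (tau t) t).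
Proof. by apply: bounded_nonneg01 => t; rewrite Pescape_ge0 Pescape_le1. Qed.

Lemma indic_escape_scons s y :
  (\1_escape (scons s y) : R) = \1_escape y.
Proof.
rewrite !indicE; congr (_ %:R); congr nat_of_bool.
by apply/idP/idP; rewrite !inE => /escape_scons.
Qed.

Lemma Pescape_residual sig s :
  Pescape sig s = Ex (step sig [::] s) (fun t => Pescape (residual sig s) t).
Proof.
rewrite /Pescape Erun_residual; last exact: path_fun_escape.
congr (Ex _ _); apply/funext => t; congr (Erun _ _ _); apply/funext => y.
exact: indic_escape_scons.
Qed.

End escape.

(** * Killing at visits: survival, and the mass of recurrent paths still alive *)

Section killing.
Variables (R : realType) (M : mdp R).
Notation S := (state M).
Implicit Types (sig : strategy M) (s t : S) (x y : nat -> S) (c : S -> R).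

Definition kill_rate c := forall t, 0 <= c t < 1.

(** Conditional on the path [x], the probability of outliving the visits at times below [n] when a
    visit to [t] kills with probability [c t]. *)
Definition alive c n x : R := \prod_(k < n) (1 - c (x k)).

Lemma alive0 c x : alive c 0 x = 1.
Proof. by rewrite /alive big_ord0. Qed.

Lemma aliveS c n x : alive c n.+1 x = alive c n x * (1 - c (x n)).
Proof. by rewrite /alive big_ord_recr. Qed.

Lemma alive_scons c n s y : alive c n.+1 (scons s y) = (1 - c s) * alive c n y.
Proof. by rewrite /alive big_ord_recl. Qed.

Lemma alive_ge0 c n x : kill_rate c -> 0 <= alive c n x.
Proof.
by move=> c01; apply: prodr_ge0 => k _; have /andP[_ /ltW] := c01 (x k); rewrite subr_ge0.
Qed.

Lemma alive_nonincreasing c x : kill_rate c ->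
  {homo (alive c)^~ x : m n / (m <= n)%N >-> n <= m}.
Proof.
move=> c01; apply/nonincreasing_seqP => n; rewrite aliveS ler_piMr ?alive_ge0//.
by have /andP[h _] := c01 (x n); rewrite lerBlDr lerDl.
Qed.

Lemma alive_le1 c n x : kill_rate c -> alive c n x <= 1.
Proof. by move=> c01; rewrite -(alive0 c x) alive_nonincreasing. Qed.

Lemma alive_ge c (k : R) x : kill_rate c -> 0 <= k <= 1 ->
  (forall n, c (x n) <= k / (2 ^ n.+1)%:R) -> forall n, 1 - k <= alive c n x.
Proof.
(* The induction needs the exact partial sum of the bounds k / 2 ^ i.+1, not just their total
   [k]. *)
move=> c01 /andP[k0 k1] ck n; suff : 1 - k * (1 - (2 ^ n)%:R^-1) <= alive c n x.
  apply: le_trans; rewrite lerD2l lerN2 ler_piMr// lerBlDr lerDl invr_ge0.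
elim: n => [|n IH]; first by rewrite alive0 expn0 invr1 subrr mulr0 subr0.
have E : (2 ^ n.+1)%:R^-1 = (2 ^ n)%:R^-1 / 2 :> R.
  by rewrite expnS mulnC natrM invfM.
have := ck n; rewrite aliveS E => h.
have Y1 := alive_le1 n x c01; have Y0 := alive_ge0 n x c01.
have /andP[c0 _] := c01 (x n).
have : alive c n x * c (x n) <= c (x n) by rewrite ler_piMl.
by rewrite mulrBr mulr1; lra.
Qed.

Definition survival c x : R := limn ((alive c)^~ x).

Lemma alive_cvg c x : kill_rate c -> alive c n x @[n --> \oo] --> survival c x.
Proof.
move=> c01; apply: nonincreasing_is_cvgn; first exact: alive_nonincreasing.
by exists 0 => _ [n _ <-]; exact: alive_ge0.
Qed.

Lemma survival_ge0 c x : kill_rate c -> 0 <= survival c x.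
Proof.
move=> c01; apply: limr_ge; first by apply/cvg_ex; exists (survival c x); exact: alive_cvg.
by near=> n; exact: alive_ge0.
Unshelve. all: by end_near. Qed.

Lemma survival_le_alive c n x : kill_rate c -> survival c x <= alive c n x.
Proof.
move=> c01; apply: nonincreasing_cvgn_ge; first exact: alive_nonincreasing.
by apply/cvg_ex; exists (survival c x); exact: alive_cvg.
Qed.

Lemma survival_le1 c x : kill_rate c -> survival c x <= 1.
Proof. by move=> c01; rewrite -(alive0 c x) survival_le_alive. Qed.

Lemma survival_ge c (k : R) x : kill_rate c -> 0 <= k <= 1 ->
  (forall n, c (x n) <= k / (2 ^ n.+1)%:R) -> 1 - k <= survival c x.
Proof.
move=> c01 k01 ck; apply: limr_ge.
  by apply/cvg_ex; exists (survival c x); exact: alive_cvg.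
by near=> n; exact: alive_ge.
Unshelve. all: by end_near. Qed.

Lemma survival_scons c s y : kill_rate c ->
  survival c (scons s y) = (1 - c s) * survival c y.
Proof.
move=> c01; apply/cvg_lim => //.
rewrite -(cvg_shiftS ((alive c)^~ (scons s y))).
rewrite (_ : [sequence _]_n = fun n => (1 - c s) * alive c n y); last first.
  by apply/funext => n; exact: alive_scons.
by apply: cvgMr; exact: alive_cvg.
Qed.

(** If the limit were positive, each of the infinitely many visits to [t] would lower [alive] by at
    least [survival c x * c t], contradicting convergence. *)
Lemma survival_recurrent c x : kill_rate c -> (forall t, 0 < c t) ->
  ~ escape x -> survival c x = 0.
Proof.
move=> c01 c0 /existsNP[t /forallNP xt]; apply/le_anti; rewrite survival_ge0// andbT.
rewrite leNgt; apply/negP => l0.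
have : (alive c n x - alive c n.+1 x) @[n --> \oo] --> survival c x - survival c x.
  apply: cvgB; first exact: alive_cvg.
  by rewrite (cvg_shiftS ((alive c)^~ x)); exact: alive_cvg.
rewrite subrr => /cvgrPdist_lt /(_ (survival c x * c t)).
rewrite mulr_gt0// => /(_ isT)[N _ NP].
have /existsNP[n /not_implyP[Nn /contrapT xn]] := xt N.
have := NP n Nn; rewrite sub0r normrN aliveS xn mulrBr mulr1 opprB addrC subrK.
rewrite ger0_norm ?mulr_ge0 ?alive_ge0// ?(ltW (c0 _))// ltr_pM2r//.
by apply/negP; rewrite -leNgt survival_le_alive.
Qed.

Lemma path_fun_alive c n : kill_rate c -> path_fun (alive c n).
Proof.
move=> c01; split; first by apply: bounded_nonneg01 => x; rewrite alive_ge0 ?alive_le1.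
move=> s; elim: n => [|n IH].
  rewrite (_ : alive c 0 = fun=> 1); first exact: measurable_cst.
  by apply/funext => x; exact: alive0.
rewrite (_ : alive c n.+1 = fun x => alive c n x * (1 - c (x n))); last first.
  by apply/funext => x; exact: aliveS.
apply: (measurable_funM IH) => _ B mB; rewrite setTI.
exact: (measurable_coord n [set t | B (1 - c t)]).
Qed.

Lemma path_fun_survival c : kill_rate c -> path_fun (survival c).
Proof.
move=> c01; split.
  by apply: bounded_nonneg01 => x; rewrite survival_ge0 ?survival_le1.
move=> s; apply: (@measurable_fun_cvg _ (seqs s) _ _ (alive c)).
  by move=> n; exact: (path_fun_alive n c01).2.
by move=> x _; exact: alive_cvg.
Qed.

(** The probability of escaping without ever being killed. The indicator matters for rates vanishing
    at some states, where recurrent paths may survive. *)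
Definition Psurvive c sig s : R := Erun sig s (fun x => \1_escape x * survival c x).

Let path_fun_Psurvive c : kill_rate c -> path_fun (fun x => \1_escape x * survival c x).
Proof.
by move=> c01; apply: path_funM; [exact: path_fun_escape|exact: path_fun_survival].
Qed.

Lemma Psurvive_ge0 c sig s : kill_rate c -> 0 <= Psurvive c sig s.
Proof. by move=> c01; exact: Erun_ge0 (path_fun_Psurvive c01). Qed.

Lemma Psurvive_le c sig s : kill_rate c -> Psurvive c sig s <= Pescape sig s.
Proof.
move=> c01; apply: le_Erun (path_fun_Psurvive c01) (path_fun_escape M) _ => x.
by rewrite ler_piMr ?survival_le1//; exact: path_fun_ge0 (path_fun_escape M).
Qed.

Lemma bounded_nonneg_Psurvive c (tau : S -> strategy M) : kill_rate c ->
  bounded_nonneg (fun t => Psurvive c (tau t) t).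
Proof.
move=> c01; apply: bounded_nonneg01 => t.
by rewrite Psurvive_ge0//= (le_trans (Psurvive_le _ _ c01)) ?Pescape_le1.
Qed.

Lemma Psurvive_residual c sig s : kill_rate c ->
  Psurvive c sig s = (1 - c s) * Ex (step sig [::] s) (fun t => Psurvive c (residual sig s) t).
Proof.
move=> c01; have /andP[c0 c1] := c01 s.
rewrite /Psurvive Erun_residual; last exact: path_fun_Psurvive.
rewrite -ExZ ?subr_ge0 ?(ltW c1)//; last exact: bounded_nonneg_Psurvive.
congr (Ex _ _); apply/funext => t.
rewrite -ErunZ ?subr_ge0 ?(ltW c1)//; last exact: path_fun_Psurvive.
congr (Erun _ _ _); apply/funext => y.
by rewrite survival_scons// indic_escape_scons mulrCA.
Qed.

(** The probability that the path is recurrent and still alive at time [n]. It starts at the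
    complement of [Pescape] and tends to 0, which makes it the remainder term when a bound is
    iterated down to [Pescape]. *)
Definition loss c n sig s : R := Erun sig s (fun x => alive c n x * \1_(~` escape) x).

Let measurable_recurrent s : measurable (~` escape : set (seqs s)).
Proof. by apply: measurableC; exact: measurable_escape. Qed.

Let path_fun_loss c n : kill_rate c ->
  path_fun (fun x => alive c n x * \1_(~` escape) x).
Proof.
move=> c01; apply: path_funM; first exact: path_fun_alive.
by apply: path_fun_indic; exact: measurable_recurrent.
Qed.

Lemma loss_ge0 c n sig s : kill_rate c -> 0 <= loss c n sig s.
Proof. by move=> c01; exact: Erun_ge0 (path_fun_loss n c01). Qed.

Lemma bounded_nonneg_loss c n (tau : S -> strategy M) : kill_rate c ->
  bounded_nonneg (fun t => loss c n (tau t) t).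
Proof.
move=> c01; apply: bounded_nonneg01 => t; rewrite loss_ge0//=.
apply: Erun_le (path_fun_loss n c01) _ => x.
rewrite indicE; case: (_ \in _); rewrite ?mulr1 ?mulr0 ?ler01//.
exact: alive_le1.
Qed.

Lemma Pescape_loss0 c sig s : kill_rate c -> Pescape sig s + loss c 0 sig s = 1.
Proof.
move=> c01; rewrite /Pescape /loss -ErunD; [|exact: path_fun_escape|exact: path_fun_loss].
have p1 : path_fun (fun _ : nat -> S => 1 : R) by exact: path_fun_cst.
transitivity (Erun sig s (fun=> 1)).
  congr (Erun _ _ _); apply/funext => x; rewrite alive0 mul1r !indicE in_setC.
  by case: (_ \in _); rewrite ?addr0 ?add0r.
apply: EFin_inj; rewrite -ErunE// integral_cst// mul1e.
exact: probability_setT.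
Qed.

Lemma loss_residual c n sig s : kill_rate c -> loss c n.+1 sig s =
  (1 - c s) * Ex (step sig [::] s) (fun t => loss c n (residual sig s) t).
Proof.
move=> c01; have /andP[c0 c1] := c01 s.
rewrite /loss Erun_residual; last exact: path_fun_loss.
rewrite -ExZ ?subr_ge0 ?(ltW c1)//; last exact: bounded_nonneg_loss.
congr (Ex _ _); apply/funext => t.
rewrite -ErunZ ?subr_ge0 ?(ltW c1)//; last exact: path_fun_loss.
congr (Erun _ _ _); apply/funext => y.
rewrite alive_scons -mulrA; congr (_ * (_ * _)); rewrite !indicE !in_setC.
congr (~~ _)%:R; by apply/idP/idP; rewrite !inE => /escape_scons.
Qed.

(** Dominated convergence with bound 1: the indicator kills the escaping paths, [survival_recurrent]
    the others. *)
Lemma loss_cvg0 c sig s : kill_rate c -> (forall t, 0 < c t) ->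
  loss c n sig s @[n --> \oo] --> (0 : R).
Proof.
move=> c01 c0.
suff : (loss c n sig s)%:E @[n --> \oo] --> 0%:E by move/fine_cvg.
pose F n x : \bar R := (alive c n x * \1_(~` escape) x)%:E.
have cvgF : {ae Pr sig s, forall x, setT x -> F n x @[n --> \oo] --> 0%E}.
  apply: aeW => x _; apply: cvg_EFin; first exact: nearW.
  rewrite (_ : _ \o _ = fun n => alive c n x * \1_(~` escape) x)//.
  have [xe|xe] := pselect (escape x).
    rewrite indicE in_setC mem_set//=.
    under eq_fun => n do rewrite mulr0.
    exact: cvg_cst.
  rewrite -[X in _ --> X](mul0r (\1_(~` escape) x)) -(survival_recurrent c01 c0 xe).
  by apply: cvgMl; exact: alive_cvg.
have leF : {ae Pr sig s, forall x n, setT x -> (`|F n x| <= (EFin \o cst 1%R) x)%E}.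
  apply: aeW => x n _; rewrite /F gee0_abs ?lee_fin; last first.
    exact: path_fun_ge0 (path_fun_loss n c01).
  rewrite indicE; case: (_ \in _); rewrite ?mulr1 ?mulr0 ?ler01//.
  exact: alive_le1.
have mF n : measurable_fun [set: seqs s] (F n).
  exact: measurable_path_fun (path_fun_loss n c01).
have int1 := finite_measure_integrable_cst (Pr sig s) 1 measurableT.
have [_ _] := dominated_convergence measurableT mF (measurable_cst _) cvgF int1 leF.
rewrite integral0 [X in X @ _ --> _ -> _](_ : _ = fun n => (loss c n sig s)%:E)//.
by apply/funext => n; rewrite /= ErunE//; exact: path_fun_loss.
Qed.

Definition visits_after t n : set (nat -> S) :=
  [set x | exists m, (n <= m)%N /\ x m = t].

Lemma measurable_visits_after t n s :
  measurable (escape `&` visits_after t n : set (seqs s)).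
Proof.
apply: measurableI; first exact: measurable_escape.
rewrite (_ : visits_after t n =
    \bigcup_(m in [set m | (n <= m)%N]) [set x | x m = t]).
  apply: measurable_bigcup_ctbl => m _.
  exact: (measurable_coord m [set u | u = t]).
apply/seteqP; split => x /=; first by move=> [m [nm xm]]; exists m.
by move=> [m nm xm]; exists m.
Qed.

(** These events decrease with [n], and their intersection is empty since an escaping path visits
    [t] for a last time. *)
Lemma Pr_visits_after sig s t (e : R) : 0 < e -> exists n,
  (Pr sig s (escape `&` visits_after t n) <= e%:E)%E.
Proof.
move=> e0; pose B n : set (seqs s) := escape `&` visits_after t n.
have mB n : measurable (B n) by exact: measurable_visits_after.
have B0 : \bigcap_n B n = set0.
  apply/seteqP; split => x // xB; have [xe _] := xB 0%N Logic.I.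
  by have [N Nx] := xe t; have [_ [m [Nm /(Nx m Nm)]]] := xB N Logic.I.
have := @nonincreasing_cvg_mu _ _ _ (Pr sig s) B _ mB _ _.
rewrite B0 measure0 => /(_ _ _ _) H.
have {}H : (Pr sig s \o B) n @[n --> \oo] --> 0%E.
  apply: H => //.
  - by apply: (@le_lt_trans _ _ 1%E); [exact: probability_le1|rewrite ltry].
  - apply/nonincreasing_seqP => n; rewrite subsetEset => x [xe [m [nm xm]]].
    by split=> //; exists m; split=> //; exact: ltnW.
have /fine_cvgP[_ /cvgrPdist_le /(_ _ e0)[n _ nP]] := H.
exists n; have := nP n (leqnn n); rewrite /= sub0r normrN => h.
have fin : Pr sig s (B n) \is a fin_num by exact: fin_num_measure.
rewrite -(fineK fin) lee_fin; apply: le_trans h; exact: ler_norm.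
Qed.

(** [N t] is a time after which an escaping path visits [t] with probability at most k / 2 ^ (pickle
    t).+1. One [k] pays for all late visits together, the other for the killing on the remaining
    paths. [N] is fixed before [c], so [c] can serve many strategies at once. *)
Lemma Pescape_le_Psurvive sig s (k : R) : 0 < k <= 1 -> exists N : S -> nat,
  forall c, kill_rate c -> (forall t, c t <= k / (2 ^ (N t).+1)%:R) ->
  Pescape sig s <= Psurvive c sig s + (k + k).
Proof.
move=> /andP[k0 k1].
have /choice[N NP] : forall t, exists n,
    (Pr sig s (escape `&` visits_after t n) <=
      (k / (2 ^ (pickle t).+1)%:R)%:E)%E.
  by move=> t; apply: Pr_visits_after; rewrite divr_gt0// ltr0n expn_gt0.
exists N => c c01 cN.
pose B t : set (nat -> S) := escape `&` visits_after t (N t).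
have mB t u : measurable (B t : set (seqs u)) by exact: measurable_visits_after.
pose B' n : set (nat -> S) := if (pickle_inv n : option S) is Some t then B t else set0.
have mB' n u : measurable (B' n : set (seqs u)).
  by rewrite /B'; case: pickle_inv => [t|]; [exact: mB|exact: measurable0].
pose bad := \bigcup_n B' n.
have mbad u : measurable (bad : set (seqs u)) by exact: bigcupT_measurable.
have badk : Erun sig s \1_bad <= k.
  rewrite -lee_fin Erun_indic//.
  apply: (le_trans (measure_sigma_subadditive (Pr sig s) (mB'^~ s) (mbad s) _)) => //.
  apply: (le_trans _ (epsilon_trick0 xpredT (ltW k0))).
  apply: lee_nneseries => // n _; rewrite /B'.
  have := @pickle_invK S n; case: pickle_inv => [t /= <-|_].
    exact: NP.
  by rewrite measure0 lee_fin divr_ge0 ?ler0n// ltW.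
have pPS := path_fun_Psurvive c01.
have pk : path_fun (fun _ : nat -> S => k) by apply: path_fun_cst; exact: ltW.
have pbad : path_fun (\1_bad : (nat -> S) -> R) by exact: path_fun_indic.
have Ik : Erun sig s (fun=> k) <= k by exact: Erun_le.
apply: (@le_trans _ _ (Psurvive c sig s + (Erun sig s (fun=> k) + Erun sig s \1_bad))); last first.
  by rewrite lerD2l lerD.
rewrite -[Erun _ _ _ + Erun _ _ _]ErunD// -ErunD//; last exact: path_funD.
apply: le_Erun => //; [exact: path_fun_escape|by apply: path_funD => //; exact: path_funD|].
move=> x; rewrite !indicE; case: (boolP (x \in escape)) => [|_]; last first.
  by rewrite mul0r add0r; apply: addr_ge0; [exact: ltW|exact: ler0n].
rewrite inE mul1r => xe.
case: (boolP (x \in bad)) => [_|xb].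
  by have := survival_ge0 x c01; rewrite /=; lra.
suff : 1 - k <= survival c x by rewrite /=; lra.
apply: survival_ge => //; first by rewrite k1 ltW.
(* Off [bad], being at [x n] at time [n] forces [n <= N (x n)], so the rate there is at most k / 2 ^
   n.+1. *)
move=> n; apply: (le_trans (cN _)).
rewrite ler_pM2l// lef_pV2 ?posrE ?ltr0n ?expn_gt0// ler_nat leq_exp2l// ltnS.
rewrite leqNgt; apply/negP => nN; move: xb; rewrite notin_setE; apply.
exists (pickle (x n)) => //; rewrite /B' pickleK_inv; split => //.
by exists n; rewrite ltnW.
Qed.

End killing.

(** * Memoryless strategies, and gluing strategies after the first step *)

Section strategies.
Variables (R : realType) (M : mdp R).
Notation S := (state M).
Implicit Types (sig : strategy M) (s t : S).

Lemma dirac_sum1 (S' : countType) (u : S') :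
  (\esum_(v in [set: S']) (v == u)%:R%:E = 1 :> \bar R)%E.
Proof.
rewrite -(@esum_set1 R _ u (fun=> 1%E))// [RHS]esum_mkcond.
by apply: eq_esum => v _; rewrite in_set1; case: eqP.
Qed.

Definition dirac_dist (S' : countType) (u : S') : dist R S' :=
  Dist (fun v => ler0n R (v == u)) (dirac_sum1 u).

Lemma md_edge (f : S -> S) (fe : forall s, edge s (f s)) (rho : seq S) s t :
  ctrl s -> 0 < dirac_dist (f s) t -> edge s t.
Proof. by move=> _ /=; case: eqP => [->|]; rewrite ?ltxx. Qed.

Definition md (f : S -> S) (fe : forall s, edge s (f s)) : strategy M :=
  Strategy (md_edge fe).

Lemma is_MD_md f fe : is_MD (@md f fe).
Proof. by exists f. Qed.

(** This turns the one-step identities into fixed-point equations for a single function of the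
    state. *)
Lemma residual_md f fe s : residual (@md f fe) s = md fe.
Proof. by congr Strategy; exact: Prop_irrelevance. Qed.

Lemma step_md_ctrl f fe rho s t : ctrl s -> step (@md f fe) rho s t = (t == f s)%:R.
Proof. by rewrite /step => ->. Qed.

Lemma step_random sig sig' rho s : ~~ ctrl s -> step sig rho s = step sig' [::] s.
Proof. by rewrite /step => /negbTE ->. Qed.

Lemma eq_Pescape sig sig' s :
  (forall w, path_prob (step sig) [::] s w = path_prob (step sig') [::] s w) ->
  Pescape sig s = Pescape sig' s.
Proof.
move=> e; apply: EFin_inj; rewrite -!Pr_Transience.
apply: (@Defs.induced_unique _ _ sig s); last exact: measurable_Transience.
  exact: Pr_induced.
by move=> w; rewrite e; exact: Pr_induced.
Qed.

(** [head s rho'] is the second state of the run: the first entry of the history after the initial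
    state, or the current state if there is none. *)
Lemma glue_edge sig (tau : S -> strategy M) rho s t :
  ctrl s -> 0 < (if rho is a :: rho' then tau (head s rho') rho' s
                 else sig [::] s) t -> edge s t.
Proof. by case: rho => [|a rho]; exact: decide_edge. Qed.

(* Plays [sig] at the first step, then forgets the initial state and follows
   [tau t], where [t] is the second state. *)
Definition glue sig (tau : S -> strategy M) : strategy M :=
  Strategy (@glue_edge sig tau).

Lemma Pescape_residual_glue sig tau s t : Pescape (residual (glue sig tau) s) t = Pescape (tau t) t.
Proof.
apply: eq_Pescape => w.
(* Generalized to every history whose second state is [t], a property kept as the run goes on. *)
suff H rho u : head u rho = t ->
    path_prob (step (residual (glue sig tau) s)) rho u w =
    path_prob (step (tau t)) rho u w by exact: H.
elim: w rho u => [//|v w IH] rho u ht /=; congr (_ * _).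
  by rewrite /step /= ht.
by apply: IH; case: rho ht.
Qed.

Lemma Pescape_glue sig tau s :
  Pescape (glue sig tau) s = Ex (step sig [::] s) (fun t => Pescape (tau t) t).
Proof.
rewrite Pescape_residual; congr (Ex _ _).
by apply/funext => t; exact: Pescape_residual_glue.
Qed.

End strategies.

(** * The largest Bellman subsolution, the choice of killing rates, and the MD strategy *)

Section potential.
Variables (R : realType) (M : mdp R).
Notation S := (state M).
Implicit Types (sig tau : strategy M) (s t : S) (u : S -> R).

(** [C s] is the class of admissible strategies from [s], and [h] the scale in which errors are
    measured. The instances are all strategies with [h] equal to 1, and optimal strategies with [h]
    the value. *)
Variables (C : S -> strategy M -> Prop) (h : S -> R) (eps : R).
Hypothesis h01 : forall s, 0 <= h s <= 1.
Hypothesis C_residual : forall s sig t, C s sig -> 0 < step sig [::] s t ->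
  C t (residual sig s).
Hypothesis C_harmonic : forall s sig, C s sig -> Ex (step sig [::] s) h = h s.
Hypothesis C_ctrl : forall s sig t, C s sig -> ctrl s -> 0 < step sig [::] s t ->
  h t = h s.
Hypothesis C_Pescape : forall s sig, C s sig -> Pescape sig s <= h s.
Hypothesis eps01 : 0 < eps <= 1.

Let eps0 : 0 < eps. Proof. by case/andP: eps01. Qed.
Let h0 s : 0 <= h s. Proof. by case/andP: (h01 s). Qed.
Let bh : bounded_nonneg h. Proof. exact: bounded_nonneg01. Qed.

Let O s := exists sig, C s sig.

Section subsolution.
Variable c : S -> R.
Hypothesis c01 : kill_rate c.

Let c1 s : 0 <= 1 - c s. Proof. by have /andP[_ /ltW] := c01 s; rewrite subr_ge0. Qed.

(** One half of the Bellman equation with a supremum over admissible strategies; [delta] allows for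
    a supremum that is not attained. *)
Definition subsolution u := (forall t, 0 <= u t <= h t) /\
  forall s delta, O s -> 0 < delta -> exists2 sig, C s sig &
    u s <= (1 - c s) * Ex (step sig [::] s) u + delta.

Definition potential s : R := sup [set u s | u in subsolution].

Lemma bounded_le_h u : (forall t, 0 <= u t <= h t) -> bounded_nonneg u.
Proof.
move=> uh; apply: bounded_nonneg01 => t; have /andP[-> /le_trans->//] := uh t.
by case/andP: (h01 t).
Qed.

Lemma subsolution0 : subsolution (fun=> 0).
Proof.
split=> [t|s delta [sig Cs] d0]; first by rewrite lexx h0.
by exists sig => //; rewrite Ex_cst// mulr0 add0r ltW.
Qed.

Let subsolution_ub s : has_ubound [set u s | u in subsolution].
Proof. by exists (h s) => _ [u [uh _] <-]; case/andP: (uh s). Qed.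

Lemma subsolution_le u s : subsolution u -> u s <= potential s.
Proof. by move=> su; apply: ub_le_sup => //; exists u. Qed.

Lemma potential_ge0 s : 0 <= potential s.
Proof. exact: (subsolution_le s subsolution0). Qed.

Lemma potential_le s : potential s <= h s.
Proof.
apply: ge_sup; first by exists 0, (fun=> 0) => //; exact: subsolution0.
by move=> _ [u [uh _] <-]; case/andP: (uh s).
Qed.

Let potential_bounds t : 0 <= potential t <= h t.
Proof. by rewrite potential_ge0 potential_le. Qed.

(** A subsolution within [delta / 2] of the supremum at [s] provides the strategy, and monotonicity
    of [Ex] replaces it by [potential]. *)
Lemma subsolution_potential : subsolution potential.
Proof.
split=> // s delta Os d0; have d20 : 0 < delta / 2 by rewrite divr_gt0.
have [|_ [u su <-] Vu] := @sup_adherent _ [set u s | u in subsolution] _ d20.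
  by split=> //; exists 0, (fun=> 0) => //; exact: subsolution0.
have [uh us] := su; have [sig Cs le] := us s _ Os d20; exists sig => //.
have : (1 - c s) * Ex (step sig [::] s) u <= (1 - c s) * Ex (step sig [::] s) potential.
  rewrite ler_wpM2l// le_Ex//; [exact: bounded_le_h|exact: bounded_le_h|].
  by move=> t _; exact: subsolution_le.
by move: Vu le; rewrite -/(potential s); lra.
Qed.

(* For [c'] obtained from [c] by setting the rates of finitely many states to 0. *)
Lemma Psurvive_le_potential (c' : S -> R) (e : R) : kill_rate c' -> 0 <= e ->
  (forall s, c' s = c s \/ forall sig, C s sig -> Pescape sig s <= potential s + e * h s) ->
  forall s sig, C s sig -> Psurvive c' sig s <= potential s + e * h s.
Proof.
move=> c'01 e0 c'c.
(* [u] is the supremum of [potential] and of the surviving probabilities lowered by [e * h]; being a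
   subsolution, it cannot exceed [potential]. *)
pose A s := [set potential s] `|` [set Psurvive c' sig s - e * h s | sig in C s].
pose u s := sup (A s).
have Psurvive_h s sig : C s sig -> Psurvive c' sig s <= h s.
  by move=> Cs; exact: le_trans (Psurvive_le _ _ c'01) (C_Pescape Cs).
have eh s : 0 <= e * h s by rewrite mulr_ge0.
have ubA s : ubound (A s) (h s).
  move=> _ [->|[sig Cs <-]]; first exact: potential_le.
  by have := Psurvive_h s sig Cs; have := eh s; lra.
have hubA s : has_ubound (A s) by exists (h s).
have Vu s : potential s <= u s by apply: ub_le_sup => //; left.
have PSu s sig : C s sig -> Psurvive c' sig s <= u s + e * h s.
  by move=> Cs; rewrite -lerBlDr; apply: ub_le_sup => //; right; exists sig.
have uh s : 0 <= u s <= h s.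
  rewrite (le_trans (potential_ge0 s))//=; apply: ge_sup => //.
  by exists (potential s); left.
have bu := bounded_le_h uh.
suff su : subsolution u.
  by move=> s sig /PSu /le_trans; apply; rewrite lerD2r; exact: subsolution_le.
split=> // s delta Os d0; have d20 : 0 < delta / 2 by rewrite divr_gt0.
(* Where [potential] nearly attains [u], its own inequality carries over. This also covers the
   states whose rate was changed. *)
have viaV : u s - delta / 2 <= potential s -> exists2 sig, C s sig &
    u s <= (1 - c s) * Ex (step sig [::] s) u + delta.
  move=> le1; have [_ /(_ s _ Os d20)[sig Cs le2]] := subsolution_potential.
  exists sig => //.
  have : (1 - c s) * Ex (step sig [::] s) potential <= (1 - c s) * Ex (step sig [::] s) u.
    by rewrite ler_wpM2l// le_Ex//; exact: bounded_le_h.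
  by lra.
have [|z Az uz] := @sup_adherent _ (A s) _ d20.
  by split=> //; exists (potential s); left.
case: Az uz => [-> /ltW|[sig Cs <-] uz]; first exact: viaV.
case: (c'c s) => [cs|/(_ sig Cs) PTV]; last first.
  by apply: viaV; have := Psurvive_le sig s c'01; move: uz; rewrite -/(u s); lra.
exists sig => //.
(* One step of the recursion; since [h] is harmonic, the correction [e * h] passes through the
   expectation. *)
have : Psurvive c' sig s <= (1 - c s) * (Ex (step sig [::] s) u + e * h s).
  rewrite Psurvive_residual// cs ler_wpM2l// -[X in e * X](C_harmonic Cs) -ExZ// -ExD//; last first.
    exact: bounded_nonnegZ.
  apply: le_Ex; [exact: bounded_nonneg_Psurvive|apply: bounded_nonnegD => //; exact: bounded_nonnegZ|].
  by move=> t dt; apply: PSu; exact: C_residual.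
have : 0 <= c s * (e * h s) by rewrite mulr_ge0//; case/andP: (c01 s).
by move: uz; rewrite -/(u s); lra.
Qed.

End subsolution.

(* Positive also where [h] vanishes: it becomes a killing rate, and these are
   to be positive. *)
Let kappa s : R := (if 0 < h s then h s else 1) * (eps / (2 ^ (pickle s).+1)%:R) / 3.

Let pow_inv n : 0 < ((2 ^ n.+1)%:R^-1 : R) <= 2^-1.
Proof.
rewrite invr_gt0 ltr0n expn_gt0/= lef_pV2 ?posrE ?ltr0n ?expn_gt0//.
by rewrite ler_nat expnS leq_pmulr// expn_gt0.
Qed.

Let kappa01 s : 0 < kappa s <= 1.
Proof.
have /andP[p0 p1] := pow_inv (pickle s); have /andP[_ e1] := eps01.
have /andP[k0 k1] : 0 < (if 0 < h s then h s else 1) <= 1.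
  by case: ifPn => [->|_]; [case/andP: (h01 s)|rewrite ltr01 lexx].
rewrite /kappa; set k := (if _ then _ else _) in k0 k1 *.
have q0 := mulr_gt0 eps0 p0.
have q1 : eps * (2 ^ (pickle s).+1)%:R^-1 <= 1.
  by rewrite -[leRHS]mulr1 ler_pM// ?ltW//; lra.
rewrite divr_gt0 ?mulr_gt0//=.
have : k * (eps / (2 ^ (pickle s).+1)%:R) <= 1 by rewrite -[leRHS]mulr1 ler_pM// ltW.
by lra.
Qed.

(** Of the three [kappa s], one is the distance of [sig] from the supremum and two come from
    [Pescape_le_Psurvive]. *)
Let near_optimal s : exists N : S -> nat, O s -> exists2 sig, C s sig &
  forall c, kill_rate c -> (forall t, c t <= kappa s / (2 ^ (N t).+1)%:R) ->
  forall tau, C s tau -> Pescape tau s <= Psurvive c sig s + 3 * kappa s.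
Proof.
have [[sig0 C0]|nO] := pselect (O s); last by exists (fun=> 0%N).
have /andP[k0 _] := kappa01 s.
pose A := [set Pescape sig s | sig in C s].
have hA : has_sup A.
  split; first by exists (Pescape sig0 s), sig0.
  by exists 1 => _ [sig _ <-]; exact: Pescape_le1.
have [_ [sig Cs <-] sigP] := sup_adherent k0 hA.
have [N NP] := Pescape_le_Psurvive sig s (kappa01 s).
exists N => _; exists sig => // c c01 cN tau Ct.
have : Pescape tau s <= sup A by apply: ub_le_sup; [case: hA|exists tau].
by have := NP c c01 cN; lra.
Qed.

(** The rate at [t] must obey the bound of each state [s] with code at most that of [t]. These are
    finitely many, so the product of their bounds is still positive, and it lies below each factor
    as all are at most 1/2. *)
Let kill_rate_ex : exists c : S -> R, [/\ kill_rate c, (forall t, 0 < c t) &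
  forall s, O s -> exists2 sig, C s sig & forall c' : S -> R, kill_rate c' ->
    (forall t, c' t = 0 \/ c' t = c t /\ (pickle s <= pickle t)%N) ->
    forall tau, C s tau -> Pescape tau s <= Psurvive c' sig s + 3 * kappa s].
Proof.
have /choice[N NP] := near_optimal.
(* Indices that code no state get 1/2, which is positive and keeps the product below 1. *)
pose a j t : R := if (pickle_inv j : option S) is Some s
  then kappa s / (2 ^ (N s t).+1)%:R else 2^-1.
have a01 j t : 0 < a j t <= 2^-1.
  rewrite /a; case: pickle_inv => [s|]; last by rewrite lexx invr_gt0 ltr0n.
  have /andP[k0 k1] := kappa01 s; have /andP[p0 p1] := pow_inv (N s t).
  by rewrite mulr_gt0//= -[leRHS]mul1r ler_pM// ltW.
have a_le1 j t : 0 <= a j t <= 1 by have /andP[] := a01 j t; lra.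
pose c t : R := \prod_(j < (pickle t).+1) a j t.
have ca t j : (j <= pickle t)%N -> c t <= a j t.
  move=> jt; rewrite /c (bigD1 (Ordinal (jt : (j < (pickle t).+1)%N)))//=.
  rewrite ler_piMr//; first by case/andP: (a_le1 j t).
  by apply: prodr_ile1 => i _; exact: a_le1.
have c0 t : 0 < c t by apply: prodr_gt0 => j _; case/andP: (a01 j t).
have c01 : kill_rate c.
  move=> t; rewrite ltW//=; have := ca t 0%N isT; have /andP[_] := a01 0%N t; lra.
exists c; split=> // s Os; have [sig Cs sigP] := NP s Os.
exists sig => // c' c'01 c'c; apply: sigP => // t.
have /andP[k0 _] := kappa01 s.
case: (c'c t) => [->|[-> st]]; first by rewrite divr_ge0 ?ler0n// ltW.
by have := ca t _ st; rewrite /a pickleK_inv.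
Qed.

(** Where [h] is positive, [3 * kappa s] is exactly the increment of the error budget from one code
    to the next. *)
Let kappa_step s : 0 < h s -> 3 * kappa s + eps * (1 - (2 ^ pickle s)%:R^-1) * h s =
  eps * (1 - (2 ^ (pickle s).+1)%:R^-1) * h s.
Proof.
move=> hs; rewrite /kappa hs.
have E : (2 ^ (pickle s).+1)%:R^-1 = (2 ^ (pickle s))%:R^-1 / 2 :> R.
  by rewrite expnS mulnC natrM invfM.
rewrite E; set p := _^-1; rewrite (mulrC 3) divfK ?pnatr_eq0//.
by rewrite !mulrBr !mulrBl; lra.
Qed.

(** The error [c s * (eps * h s)] carries the factor [c s], so a process started at [s] is charged
    for it only in proportion to the mass killed, at most [eps * h s] in total as [h] is
    harmonic. *)
Lemma md_potential : exists (c V : S -> R) (sig : strategy M), [/\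
    [/\ kill_rate c, (forall t, 0 < c t), is_MD sig & forall s, residual sig s = sig],
    (forall s, 0 <= V s <= h s),
    (forall s tau, C s tau -> Pescape tau s <= V s + eps * h s) &
    forall s tau, C s tau ->
    [/\ V s <= (1 - c s) * Ex (step sig [::] s) V + c s * (eps * h s),
        Ex (step sig [::] s) h = h s &
        forall t, 0 < step sig [::] s t -> exists tau', C t tau']].
Proof.
have [c [c01 c0 cP]] := kill_rate_ex.
pose V := potential c; exists c, V.
have Vh s : 0 <= V s <= h s by rewrite potential_ge0 potential_le.
have bV : bounded_nonneg V by exact: bounded_le_h.
(* The error budget of the states with code below [n]; it stays under [eps]. *)
pose E n : R := eps * (1 - (2 ^ n)%:R^-1).
have E_homo m n : (m <= n)%N -> E m <= E n.
  move=> mn; rewrite /E ler_wpM2l ?(ltW eps0)// lerD2l lerN2.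
  by rewrite lef_pV2 ?posrE ?ltr0n ?expn_gt0// ler_nat leq_exp2l.
have E_ge0 n : 0 <= E n.
  by apply: le_trans (E_homo _ _ (leq0n n)); rewrite /E expn0 invr1 subrr mulr0.
have PTV n : forall s, pickle s = n -> forall tau, C s tau ->
    Pescape tau s <= V s + E n.+1 * h s.
  elim/ltn_ind: n => n IH s sn tau Ct.
  (* Killing is switched off at the states before [s]; there the induction hypothesis supplies the
     bound that [Psurvive_le_potential] requires. *)
  pose c' t := if (n <= pickle t)%N then c t else 0.
  have c'01 : kill_rate c'.
    by move=> t; rewrite /c'; case: ifP => _; [exact: c01|rewrite lexx ltr01].
  have [|sig Cs sigP] := cP s; first by exists tau.
  have := sigP c' c'01 _ tau Ct.
  have -> : (forall t, c' t = 0 \/ c' t = c t /\ (pickle s <= pickle t)%N) <-> True.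
    split=> // _ t; rewrite /c' sn; case: ifP => _; by [right|left].
  move=> /(_ Logic.I) le1.
  have le2 : Psurvive c' sig s <= V s + E n * h s.
    apply: (Psurvive_le_potential c01 c'01) => // t; rewrite /c'.
    case: leqP => [_|tn]; [by left|right => sig' Ct'].
    apply: (le_trans (IH _ tn t erefl sig' Ct')).
    by rewrite lerD2l ler_wpM2r// E_homo.
  have := h0 s; rewrite le_eqVlt => /predU1P[hs|hs].
    have /andP[V0 _] := Vh s.
    by have := C_Pescape Ct; rewrite -hs mulr0; lra.
  by have := kappa_step hs; rewrite sn -!/(E _); lra.
have fP s : exists t, edge s t /\ (ctrl s -> O s -> [/\ O t, h t = h s &
    V s <= (1 - c s) * V t + c s * (eps * h s)]).
  have [[cs Os]|nco] := pselect (ctrl s /\ O s); last first.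
    have [t st] := edge_total s; exists t; split=> // cs Os.
    by exfalso; exact: nco.
  have [sig Cs le] : exists2 sig, C s sig &
      V s <= (1 - c s) * Ex (step sig [::] s) V + c s * (eps * h s).
    (* If [h s = 0] then [V s = 0] and any admissible strategy will do; otherwise the allowed error
       is positive and can serve as [delta]. *)
    have := h0 s; rewrite le_eqVlt => /predU1P[hs|hs].
      have [sig Cs] := Os; exists sig => //; rewrite -hs !mulr0 addr0.
      have /andP[_ V0] := Vh s; rewrite -hs in V0; apply: (le_trans V0).
      by rewrite mulr_ge0 ?Ex_ge0// subr_ge0; case/andP: (c01 s) => _ /ltW.
    have [_ /(_ s (c s * (eps * h s)) Os)] := subsolution_potential c01.
    by apply; rewrite !mulr_gt0.
  (* Some successor in the support does at least as well as the mean, so the choice can be made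
     deterministic. *)
  have [t dt tV] := Ex_mean (step sig [::] s) bV; exists t.
  split; first exact: step_edge dt.
  move=> _ _; split; [by exists (residual sig s); exact: C_residual|exact: C_ctrl dt|].
  apply: (le_trans le); rewrite lerD2r ler_wpM2l// subr_ge0.
  by case/andP: (c01 s) => _ /ltW.
have /choice[f f_spec] := fP.
have fe s : edge s (f s) by case: (f_spec s).
exists (md fe); split=> //.
- by split=> //; [exact: is_MD_md|move=> s; exact: residual_md].
- move=> s tau Ct; apply: (le_trans (PTV _ s erefl tau Ct)).
  by rewrite lerD2l ler_wpM2r// /E ler_piMr ?(ltW eps0)// lerBlDr lerDl invr_ge0.
move=> s tau Ct; have Os : O s by exists tau.
have [cs|ncs] := boolP (ctrl s).
  have [_ /(_ cs Os)[Ot ht le]] := f_spec s.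
  have dE t : step (md fe) [::] s t = (t == f s)%:R by exact: step_md_ctrl.
  rewrite !(Ex_dirac _ dE)//; split=> // t.
  by rewrite dE; case: eqP => [->//|_]; rewrite ltxx.
(* At a random state all strategies make the same step, so what an admissible one satisfies holds
   for [md fe]. *)
rewrite (step_random (md fe) tau [::] ncs) (C_harmonic Ct); split=> //; last first.
  by move=> t dt; exists (residual tau s); exact: C_residual.
have := h0 s; rewrite le_eqVlt => /predU1P[hs|hs].
  have /andP[_ V0] := Vh s; rewrite -hs in V0; apply: (le_trans V0).
  rewrite -hs !mulr0 addr0 mulr_ge0 ?Ex_ge0// subr_ge0.
  by case/andP: (c01 s) => _ /ltW.
have [_ /(_ s (c s * (eps * h s)) Os)] := subsolution_potential c01.
rewrite !mulr_gt0// => /(_ isT)[sig Cs].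
by rewrite (step_random sig tau [::] ncs).
Qed.

End potential.

(** * The value of [Transience], and the two MD strategies *)

Lemma le_add_cvg0 (R : realType) (a b : R) (u : nat -> R) :
  u n @[n --> \oo] --> (0 : R) -> (forall n, a <= b + u n) -> a <= b.
Proof.
move=> u0 le; apply/ler_addgt0Pr => e e0.
have /cvgrPdist_lt /(_ _ e0)[n _ /(_ n (leqnn n))] := u0.
rewrite /= sub0r normrN => un; apply: (le_trans (le n)); rewrite lerD2l.
exact: le_trans (ler_norm _) (ltW un).
Qed.

Section transience_value.
Variables (R : realType) (M : mdp R).
Notation S := (state M).
Implicit Types (sig tau : strategy M) (s t : S).

Definition val s : R := sup [set Pescape sig s | sig in [set: strategy M]].

Lemma succ_ex : exists f : S -> S, forall s, edge s (f s).
Proof. by have /choice[f fe] := @edge_total R M; exists f. Qed.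

Let Pescape_has_sup s : has_sup [set Pescape sig s | sig in [set: strategy M]].
Proof.
split; last by exists 1 => _ [sig _ <-]; exact: Pescape_le1.
by have [f fe] := succ_ex; exists (Pescape (md fe) s), (md fe).
Qed.

Lemma Pescape_le_val sig s : Pescape sig s <= val s.
Proof. by apply: ub_le_sup; [case: (Pescape_has_sup s)|exists sig]. Qed.

Lemma val_bounds s : 0 <= val s <= 1.
Proof.
have [f fe] := succ_ex.
rewrite (le_trans (Pescape_ge0 (md fe) s) (Pescape_le_val _ _))/=.
by apply: ge_sup => [|_ [sig _ <-]]; [case: (Pescape_has_sup s)|exact: Pescape_le1].
Qed.

Lemma bounded_nonneg_val : bounded_nonneg val.
Proof. exact: bounded_nonneg01 val_bounds. Qed.

Lemma value_Transience s : value (@Transience R M) s = (val s)%:E.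
Proof.
rewrite /value /val -ereal_sup_EFin; [|by case: (Pescape_has_sup s)..].
rewrite image_comp; congr ereal_sup; apply: eq_imagel => sig _.
by rewrite /= Pr_Transience.
Qed.

Lemma optimal_Transience sig s :
  optimal (@Transience R M) sig s <-> Pescape sig s = val s.
Proof.
rewrite /optimal value_Transience Pr_Transience.
by split=> [[]|->].
Qed.

(** Play [sig] for one step, then an [e]-optimal strategy from the state reached. *)
Lemma val_superharmonic sig s : Ex (step sig [::] s) val <= val s.
Proof.
apply/ler_addgt0Pr => e e0.
have /choice[tau tauP] : forall t, exists tau, val t <= Pescape tau t + e.
  move=> t; have [_ [tau _ <-] h] := sup_adherent e0 (Pescape_has_sup t).
  by exists tau; rewrite -lerBlDr ltW.
apply: (@le_trans _ _ (Ex (step sig [::] s) (fun t => Pescape (tau t) t + e))).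
  apply: le_Ex => //; first exact: bounded_nonneg_val.
  by apply: bounded_nonnegD; [exact: bounded_nonneg_Pescape|apply: bounded_nonneg_cst; exact: ltW].
rewrite ExD ?Ex_cst ?(ltW e0)//; [|exact: bounded_nonneg_Pescape|].
  by rewrite -Pescape_glue lerD2r Pescape_le_val.
by apply: bounded_nonneg_cst; exact: ltW.
Qed.

Lemma val_ctrl_edge s t : ctrl s -> edge s t -> val t <= val s.
Proof.
move=> cs st; have [f fe] := succ_ex.
pose g u := if u == s then t else f u.
have ge u : edge u (g u) by rewrite /g; case: eqP => [->|].
apply: le_trans (val_superharmonic (md ge) s).
rewrite (@Ex_dirac _ _ _ t)//; first exact: bounded_nonneg_val.
by move=> u; rewrite step_md_ctrl// /g eqxx.
Qed.

Let bv := bounded_nonneg_val.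

(** Residual probabilities lie below [val] but have mean [val s], which is at least the mean of
    [val]; [Ex_squeeze] gives equality on the support. *)
Lemma optimal_residual sig s t : Pescape sig s = val s -> 0 < step sig [::] s t ->
  Pescape (residual sig s) t = val t.
Proof.
move=> e; apply: (@Ex_squeeze _ _ _ (fun t => Pescape (residual sig s) t) val) => //.
- exact: bounded_nonneg_Pescape.
- by move=> u _; exact: Pescape_le_val.
- by rewrite -Pescape_residual e val_superharmonic.
Qed.

Lemma optimal_harmonic sig s : Pescape sig s = val s -> Ex (step sig [::] s) val = val s.
Proof.
move=> e; rewrite -[RHS]e Pescape_residual; apply: eq_Ex => //.
  exact: bounded_nonneg_Pescape.
by move=> t dt; rewrite optimal_residual.
Qed.

(** No successor of a controlled state has a larger value, and by harmonicity the mean is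
    [val s]. *)
Lemma optimal_ctrl sig s t : Pescape sig s = val s -> ctrl s -> 0 < step sig [::] s t ->
  val t = val s.
Proof.
move=> e cs; have v0 : 0 <= val s by case/andP: (val_bounds s).
apply: (@Ex_squeeze _ _ _ val (fun=> val s)) => //; first exact: bounded_nonneg_cst.
  by move=> u /step_edge; exact: val_ctrl_edge.
by rewrite Ex_cst// (optimal_harmonic e).
Qed.

Lemma eps_optimal_MD (eps : R) : 0 < eps -> exists2 sig,
  is_MD sig & forall s, val s <= Pescape sig s + eps.
Proof.
move=> eps0; pose e := Num.min eps 1 / 2.
have e01 : 0 < e <= 1.
  rewrite divr_gt0 ?lt_min ?eps0//=; have : Num.min eps 1 <= 1 by rewrite ge_min lexx orbT.
  by rewrite /e; lra.
have e_eps : e + e <= eps.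
  have : Num.min eps 1 <= eps by rewrite ge_min lexx.
  by rewrite /e; lra.
have e0 : 0 <= e by case/andP: e01 => /ltW.
have [||||||c [V [sig [[c01 c0 sigMD sig_res] V01 PTV sigP]]]] :=
    @md_potential R M (fun _ _ => True) (fun=> 1) e.
- by move=> s; rewrite lexx ler01.
- by [].
- by move=> s tau _; rewrite Ex_cst.
- by [].
- by move=> s tau _; exact: Pescape_le1.
- exact: e01.
exists sig => // s; apply: ge_sup; first by case: (Pescape_has_sup s).
move=> _ [tau _ <-]; apply: (le_trans (PTV s tau Logic.I)).
suff : V s <= Pescape sig s + e by move: e_eps; lra.
(* The bound by [Pescape + e + loss] is kept by a step: surviving mass carries [e] along, killed
   mass is charged [e]. At [n = 0] its right side is at least 1. *)
apply: (le_add_cvg0 (loss_cvg0 sig s c01 c0)) => n; elim: n s => [|n IH] s.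
  by rewrite addrAC Pescape_loss0//; have /andP[_] := V01 s; lra.
have [le _ _] := sigP s sig Logic.I; apply: (le_trans le).
have bPT : bounded_nonneg (fun t => Pescape sig t) by exact: (bounded_nonneg_Pescape (fun=> sig)).
have bl : bounded_nonneg (loss c n sig) by exact: (bounded_nonneg_loss n (fun=> sig)).
have be : bounded_nonneg (fun _ : S => e) by exact: bounded_nonneg_cst.
have /andP[cs0 /ltW cs1] := c01 s.
have : Ex (step sig [::] s) V <= Ex (step sig [::] s) (fun t => Pescape sig t + e + loss c n sig t).
  apply: le_Ex => //; first exact: bounded_nonneg01.
  by apply: bounded_nonnegD => //; exact: bounded_nonnegD.
rewrite ExD//; last exact: bounded_nonnegD.
rewrite ExD// Ex_cst// => h1.
have g_harm : Pescape sig s = Ex (step sig [::] s) (fun t => Pescape sig t).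
  by rewrite Pescape_residual sig_res.
have l_eq : loss c n.+1 sig s = (1 - c s) * Ex (step sig [::] s) (loss c n sig).
  by rewrite loss_residual// sig_res.
rewrite -g_harm in h1; rewrite l_eq.
have h2 : (1 - c s) * Ex (step sig [::] s) V <=
    (1 - c s) * (Pescape sig s + e + Ex (step sig [::] s) (loss c n sig)).
  by rewrite ler_wpM2l// subr_ge0.
have : 0 <= c s * Pescape sig s by rewrite mulr_ge0 ?Pescape_ge0.
by lra.
Qed.

Lemma uniformly_optimal_MD : exists2 sig, is_MD sig &
  forall s tau, Pescape tau s = val s -> Pescape sig s = val s.
Proof.
pose e : R := 4^-1.
have [||||||c [V [sig [[c01 c0 sigMD sig_res] V01 PTV sigP]]]] :=
    @md_potential R M (fun s tau => Pescape tau s = val s) val e.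
- exact: val_bounds.
- by move=> s tau t; exact: optimal_residual.
- by move=> s tau; exact: optimal_harmonic.
- by move=> s tau t; exact: optimal_ctrl.
- by move=> s tau ->.
- by rewrite /e; lra.
pose O s := exists tau, Pescape tau s = val s.
have {}sigP s : O s -> [/\ V s <= (1 - c s) * Ex (step sig [::] s) V + c s * (e * val s),
   Ex (step sig [::] s) val = val s & forall t, 0 < step sig [::] s t -> O t].
  by move=> [tau /sigP].
have v0 s : 0 <= val s by case/andP: (val_bounds s).
have bV : bounded_nonneg V.
  apply: bounded_nonneg01 => s; have /andP[-> /le_trans->//] := V01 s.
  by case/andP: (val_bounds s).
have cs s : 0 <= c s <= 1 by have /andP[-> /ltW] := c01 s.
have cs1 s : 0 <= 1 - c s by rewrite subr_ge0; case/andP: (cs s).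
(* The expected value of the state at time [n] under [sig], counting only the mass not yet
   killed. *)
pose B := fix B n s : R :=
  if n is n'.+1 then (1 - c s) * Ex (step sig [::] s) (B n') else val s.
have bB n : bounded_nonneg (B n).
  elim: n => [//|n IH]; have [C CP] := IH; exists C => s /=.
  rewrite mulr_ge0 ?Ex_ge0//=.
  have C0 : 0 <= C by have /andP[/le_trans] := CP s; apply.
  have : Ex (step sig [::] s) (B n) <= C.
    rewrite -[leRHS](Ex_cst (step sig [::] s))//.
    by apply: le_Ex => [//||t _]; [exact: bounded_nonneg_cst|case/andP: (CP t)].
  have := cs s; have := Ex_ge0 (step sig [::] s) IH; move: (Ex _ _) => x x0 /andP[? ?] xC.
  by apply: le_trans xC; rewrite ler_piMl// lerBlDr lerDl.
(* Iterating the inequality for [V]; the errors add up to at most [e * val s] because [val] is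
   harmonic under [sig] on [O]. *)
have VB n s : O s -> V s <= B n s + e * val s.
  elim: n s => [|n IH] s Os.
    have /andP[_ /le_trans] := V01 s; apply; rewrite /= lerDl mulr_ge0//.
    by rewrite /e; lra.
  have [le vh cl] := sigP s Os; apply: (le_trans le) => /=.
  have : Ex (step sig [::] s) V <= Ex (step sig [::] s) (fun t => B n t + e * val t).
    apply: le_Ex => //; last by move=> t /cl; exact: IH.
    by apply: bounded_nonnegD => //; apply: bounded_nonnegZ => //; rewrite /e; lra.
  rewrite ExD ?ExZ ?vh//; last by apply: bounded_nonnegZ => //; rewrite /e; lra.
  2: by rewrite /e; lra.
  move=> /(ler_wpM2l (cs1 s)); lra.
(* As [2 * e] is 1/2, at least half of the value survives at every time. *)
have vB n s : O s -> val s <= B n s + 2 * e * val s.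
  by move=> Os; have [tau Ct] := Os; have := PTV s tau Ct; rewrite Ct; have := VB n s Os; lra.
have halve (th : R) : 0 <= th -> (forall s, O s -> val s <= Pescape sig s + th * val s) ->
    forall s, O s -> val s <= Pescape sig s + th / 2 * val s.
  move=> th0 vg s Os; apply: (le_add_cvg0 (loss_cvg0 sig s c01 c0)) => n.
  (* Only killed mass is charged the defect [th * val]; the term [th * B n s] refunds the surviving
     part, which by [vB] is at least half. *)
  suff : val s + th * B n s <= Pescape sig s + loss c n sig s + th * val s.
    have : th * val s <= th * (B n s + 2 * e * val s) by rewrite ler_wpM2l// vB.
    by rewrite /e; lra.
  elim: n s Os => [|n IH] s Os.
    by rewrite Pescape_loss0//= lerD2r; case/andP: (val_bounds s).
  have [_ vh cl] := sigP s Os.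
  have bPT : bounded_nonneg (fun t => Pescape sig t) by exact: (bounded_nonneg_Pescape (fun=> sig)).
  have bl : bounded_nonneg (loss c n sig) by exact: (bounded_nonneg_loss n (fun=> sig)).
  have g_harm : Pescape sig s = Ex (step sig [::] s) (fun t => Pescape sig t).
    by rewrite Pescape_residual sig_res.
  have l_eq : loss c n.+1 sig s = (1 - c s) * Ex (step sig [::] s) (loss c n sig).
    by rewrite loss_residual// sig_res.
  have bthv : bounded_nonneg (fun t => th * val t) by exact: bounded_nonnegZ.
  have bthB : bounded_nonneg (fun t => th * B n t) by exact: bounded_nonnegZ.
  have bgl : bounded_nonneg (fun t => Pescape sig t + loss c n sig t) by exact: bounded_nonnegD.
  have : Ex (step sig [::] s) (fun t => val t + th * B n t) <=
      Ex (step sig [::] s) (fun t => Pescape sig t + loss c n sig t + th * val t).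
    apply: le_Ex; [exact: bounded_nonnegD|exact: bounded_nonnegD|].
    by move=> t /cl; exact: IH.
  rewrite !ExD// !ExZ// -g_harm vh => /(ler_wpM2l (cs1 s)).
  have /andP[cs0 _] := cs s.
  (* The fraction [c s] killed at [s] uses the assumed bound at [s]; the remaining fraction uses the
     induction hypothesis. *)
  have := ler_wpM2l cs0 (vg s Os); rewrite l_eq /=; lra.
exists sig => // s tau Ct; have Os : O s by exists tau.
apply/le_anti; rewrite Pescape_le_val/=.
(* The trivial defect bound with factor 1 is halved [k] times. *)
have v_half k s' : O s' -> val s' <= Pescape sig s' + 2^-1 ^+ k * val s'.
  elim: k s' => [|k IH] s' Os'.
    by rewrite expr0 mul1r lerDr Pescape_ge0.
  by rewrite exprSr; apply: halve.
apply: (@le_add_cvg0 _ _ _ (fun k => 2^-1 ^+ k * val s)) => [|k]; last exact: v_half.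
rewrite -[X in _ --> X](mul0r (val s)); apply: cvgMl; apply: cvg_expr.
by rewrite ger0_norm ?invr_ge0// invf_lt1// ltr1n.
Qed.

End transience_value.

Theorem theorem8 (R : realType) (M : mdp R) :
  (forall eps : R, 0 < eps ->
     exists sigma : strategy M, is_MD sigma /\
       forall s : state M,
         (value (@Transience R M) s - eps%:E <= Pr sigma s (@Transience R M))%E)
  /\
  (exists sigma : strategy M, is_MD sigma /\
     forall s : state M,
       (exists tau : strategy M, optimal (@Transience R M) tau s) ->
       optimal (@Transience R M) sigma s).
Proof.
split=> [eps eps0|].
  have [sig sigMD sigP] := eps_optimal_MD M eps0; exists sig; split=> // s.
  by rewrite value_Transience Pr_Transience -EFinB lee_fin lerBlDr.
have [sig sigMD sigP] := uniformly_optimal_MD M; exists sig; split=> // s.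
by move=> [tau /optimal_Transience tau_opt]; apply/optimal_Transience; exact: sigP tau_opt.
Qed.
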